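(* Let $\Gamma$ be a finite set of ground term equations over a signature $\Sigma$. Each $\sim_\Gamma$-congruence class of ground terms is infinite if and only if each constant of $\Sigma$ is of cyclic type. Thus, for a fixed $\Sigma$, the intrinsic infinity problem (given $\Gamma$, decide whether every $\sim_\Gamma$-congruence class is infinite) is decidable in time polynomial in $|\Gamma|$.
   Context: $\Sigma$ is a finite functional signature having function symbols (of positive arity) and constant symbols. $\mathcal{F}$ is the algebra of all ground terms (terms without variables) over $\Sigma$. A ground term equation is an expression $p=q$ with $p,q$ ground terms. For a finite set $\Gamma$ of such equations, $\sim_\Gamma$ is the smallest congruence on $\mathcal{F}$ containing all pairs $(p,q)$ with $p=q$ in $\Gamma$ (equivalently, $p\sim_\Gamma q$ iff $\Gamma\vdash p=q$). The size $|t|$ of a ground term is the number of nodes of its syntax tree, and $|\Gamma|=\sum_{(p=q)\in\Gamma}(|p|+|q|)$. Types. Let $V_\Gamma$ be the set of ground terms $p$ such that $p=q$ or $q=p$ is in $\Gamma$ for some $q$. Let $C_1,\dots,C_k$ be the distinct classes of $V_\Gamma$ under $\sim_\Gamma$. A ground term $t$ has type $i$ if $t\sim_\Gamma p$ for some $p\in C_i$; otherwise $t$ has no type. The graph $R_\Gamma$. Take the disjoint union, over $p\in V_\Gamma$, of the syntax trees of $p$, with directed edges from each node to its children. Each node thus represents a subterm of some $p\in V_\Gamma$; a node has type $i$ if the subterm it represents has type $i$, and is labelled $0$ if that subterm has no type. Add an undirected edge between every pair of distinct nodes having the same type $i>0$. The directed graph $\widehat{R_\Gamma}$ is the quotient of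 $R_\Gamma$ obtained by identifying nodes connected by an undirected edge (so all nodes of the same type $i>0$ are identified, and nodes labelled $0$ are not identified with any other node). There is a directed edge from $[v]$ to $[w]$ if there are $v'\in[v]$ and $w'\in[w]$ with a directed edge from $v'$ to $w'$ in $R_\Gamma$. A type $i$ is cyclic if some directed cycle of $\widehat{R_\Gamma}$ (self-loops count as cycles) is reachable by a directed path from the node of type $i$. A term is of cyclic type if it has a type and that type is cyclic. *)

(* Defs.v *)
From HB Require Import structures.
From Stdlib Require Import Relation_Operators.
From mathcomp Require Import all_boot all_order all_algebra.
From mathcomp Require Import boolp classical_sets cardinality.

Set Implicit Arguments.
Unset Strict Implicit.
Unset Printing Implicit Defensive.

Local Open Scope nat_scope.

(** * Signatures and ground terms *)

(* The constant symbols are the symbols of arity 0. *)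
Record signature := Signature { symbol : finType; arity : symbol -> nat }.

Inductive term (S : signature) : Type :=
  App (f : symbol S) of {ffun 'I_(arity f) -> term S}.

Definition const_term (S : signature) (c : symbol S) (hc : arity c = 0) :
  term S := App (ffun0 (etrans (card_ord (arity c)) hc)).

Fixpoint term_size (S : signature) (t : term S) : nat :=
  let: App f ts := t in (\sum_(i < arity f) term_size (ts i)).+1.

Lemma term_induction (S : signature) (P : term S -> Prop) :
  (forall (f : symbol S) (ts : {ffun 'I_(arity f) -> term S}),
     (forall i, P (ts i)) -> P (App ts)) ->
  forall t, P t.
Proof.
move=> IH; fix loop 1 => -[f ts]; apply: IH => i; exact: loop.
Qed.

Fixpoint term_tree (S : signature) (t : term S) : GenTree.tree (symbol S) :=
  let: App f ts := t in
  GenTree.Node 0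
    (GenTree.Leaf f :: [seq term_tree (ts i) | i <- enum 'I_(arity f)]).

Lemma term_tree_inj (S : signature) : injective (@term_tree S).
Proof.
elim/term_induction => f ts IH [g us] /= [fg]; subst g => /eq_in_map E.
by congr App; apply/ffunP => i; apply/IH/E; rewrite mem_enum.
Qed.

HB.instance Definition _ (S : signature) :=
  Equality.copy (term S) (inj_type (@term_tree_inj S)).

(** * Ground term equations and the congruence they generate *)

Definition equation (S : signature) : Type := (term S * term S)%type.

(* A finite set of equations is presented by a list of its elements. *)
Definition eqs_size (S : signature) (Gamma : seq (equation S)) : nat :=
  \sum_(e <- Gamma) (term_size e.1 + term_size e.2).

Inductive cong (S : signature) (Gamma : seq (equation S)) :
  term S -> term S -> Prop :=
| cong_ax p q : (p, q) \in Gamma -> cong Gamma p q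
| cong_refl t : cong Gamma t t
| cong_sym t u : cong Gamma t u -> cong Gamma u t
| cong_trans t u v : cong Gamma t u -> cong Gamma u v -> cong Gamma t v
| cong_app (f : symbol S) (ts us : {ffun 'I_(arity f) -> term S}) :
    (forall i, cong Gamma (ts i) (us i)) -> cong Gamma (App ts) (App us).

Definition cong_class (S : signature) (Gamma : seq (equation S)) (t : term S) :
  set (term S) := [set u | cong Gamma t u]%classic.

Definition all_classes_infinite (S : signature) (Gamma : seq (equation S)) :
  Prop := forall t, infinite_set (cong_class Gamma t).

(** * Types *)

Definition eqs_sides (S : signature) (Gamma : seq (equation S)) :
  seq (term S) := undup ([seq e.1 | e <- Gamma] ++ [seq e.2 | e <- Gamma]).

(* The classes C_1, ..., C_k of the sides of the equations. A type is this
   class itself instead of its index in an arbitrary enumeration. *)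
Definition is_type (S : signature) (Gamma : seq (equation S))
    (C : set (term S)) : Prop :=
  exists2 p, p \in eqs_sides Gamma &
    C = [set q | q \in eqs_sides Gamma /\ cong Gamma p q]%classic.

Definition has_type (S : signature) (Gamma : seq (equation S))
    (t : term S) (C : set (term S)) : Prop :=
  is_type Gamma C /\ exists2 p, C p & cong Gamma t p.

(** * The mixed graph on the nodes of the syntax trees, and its quotient *)

(* A node of a syntax tree is given by the list of child indices on the path
   from the root to it. *)
Fixpoint subterm_at (S : signature) (t : term S) (pi : seq nat) :
  option (term S) :=
  if pi is i :: pi' then
    let: App f ts := t in
    if insub i is Some j then subterm_at (ts j) pi' else None
  else Some t.

Definition node (S : signature) (Gamma : seq (equation S)) : Type :=
  {v : term S * seq nat | (v.1 \in eqs_sides Gamma) && subterm_at v.1 v.2}.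

Definition node_has_type (S : signature) (Gamma : seq (equation S))
    (v : node Gamma) (C : set (term S)) : Prop :=
  exists2 s, subterm_at (val v).1 (val v).2 = Some s & has_type Gamma s C.

Definition child_edge (S : signature) (Gamma : seq (equation S))
    (v w : node Gamma) : Prop :=
  (val w).1 = (val v).1 /\ exists i, (val w).2 = rcons (val v).2 i.

Definition type_edge (S : signature) (Gamma : seq (equation S))
    (v w : node Gamma) : Prop :=
  v <> w /\ exists C, node_has_type v C /\ node_has_type w C.

(* The vertices of the quotient are the sets [v]. *)
Definition quot_vertex (S : signature) (Gamma : seq (equation S))
    (v : node Gamma) : set (node Gamma) :=
  [set w | clos_refl_sym_trans _ (@type_edge S Gamma) v w]%classic.

Definition quot_edge (S : signature) (Gamma : seq (equation S)) :
  rel (set (node Gamma)) :=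
  fun X Y => `[< exists v w, [/\ X = quot_vertex v, Y = quot_vertex w &
    exists v' w', [/\ X v', Y w' & child_edge v' w']] >].

(* [p] is a directed path from the vertex of type [C] to a vertex on the
   directed cycle [c]. *)
Definition cyclic_type (S : signature) (Gamma : seq (equation S))
    (C : set (term S)) : Prop :=
  exists2 v : node Gamma, node_has_type v C &
    exists p c : seq (set (node Gamma)),
      [/\ path (@quot_edge S Gamma) (quot_vertex v) p,
          ucycle (@quot_edge S Gamma) c &
          last (quot_vertex v) p \in c].

Definition of_cyclic_type (S : signature) (Gamma : seq (equation S))
    (t : term S) : Prop :=
  exists2 C, has_type Gamma t C & cyclic_type Gamma C.

(** * Deterministic multi-tape Turing machines and polynomial time *)

Inductive move := MoveLeft | Stay | MoveRight.

(* There are [tm_ntapes.+1] tapes, and the input is written on tape [ord0].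
   [tm_answer q = Some b] means that [q] is a halting state with verdict [b]. *)
Record TM (I : finType) := MkTM {
  tm_ntapes : nat;
  tm_sym : finType;
  tm_blank : tm_sym;
  tm_input : I -> tm_sym;
  tm_state : finType;
  tm_start : tm_state;
  tm_answer : tm_state -> option bool;
  tm_delta : tm_state -> {ffun 'I_tm_ntapes.+1 -> tm_sym} ->
    tm_state * ('I_tm_ntapes.+1 -> tm_sym * move)
}.

(* A two-way infinite tape, blank beyond the two lists; the cells to the left
   of the head are listed from the head outwards. *)
Record tape (A : Type) := Tape { t_left : seq A; t_head : A; t_right : seq A }.

Definition tape_of_word (A : Type) (blank : A) (w : seq A) : tape A :=
  Tape [::] (head blank w) (behead w).

Definition tape_act (A : Type) (blank : A) (a : A * move) (T : tape A) :
  tape A :=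
  match a.2 with
  | MoveLeft => Tape (behead (t_left T)) (head blank (t_left T))
                     (a.1 :: t_right T)
  | Stay => Tape (t_left T) a.1 (t_right T)
  | MoveRight => Tape (a.1 :: t_left T) (head blank (t_right T))
                      (behead (t_right T))
  end.

Definition tm_config (I : finType) (M : TM I) : Type :=
  (tm_state M * ('I_(tm_ntapes M).+1 -> tape (tm_sym M)))%type.

Definition tm_init (I : finType) (M : TM I) (w : seq I) : tm_config M :=
  (tm_start M,
   fun k => tape_of_word (tm_blank M)
              (if k == ord0 then map (@tm_input _ M) w else [::])).

Definition tm_step (I : finType) (M : TM I) (c : tm_config M) : tm_config M :=
  if tm_answer c.1 is Some _ then c else
  let: (q, acts) := tm_delta c.1 [ffun k => t_head (c.2 k)] in
  (q, fun k => tape_act (tm_blank M) (acts k) (c.2 k)).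

Definition tm_answers_within (I : finType) (M : TM I) (w : seq I) (n : nat)
    (b : bool) : Prop :=
  exists2 t, t <= n & tm_answer (iter t (@tm_step _ M) (tm_init M w)).1 = Some b.

(* The decision problem "given [x], does [P x] hold?", with the input [x]
   written as the word [enc x], is decidable in time polynomial in [size x]. *)
Definition ptime_decidable (I : finType) (X : Type) (enc : X -> seq I)
    (size : X -> nat) (P : X -> Prop) : Prop :=
  exists (M : TM I) (p : {poly nat}), forall x, exists b : bool,
    tm_answers_within M (enc x) p.[size x]%R b /\ (b <-> P x).

(* Polish notation: as the arities are fixed, no separators are needed, and
   the length of the word is exactly the size (see [size_eqs_word]). *)
Fixpoint term_word (S : signature) (t : term S) : seq (symbol S) :=
  let: App f ts := t in
  f :: flatten [seq term_word (ts i) | i <- enum 'I_(arity f)].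

Definition eqs_word (S : signature) (Gamma : seq (equation S)) :
  seq (symbol S) := flatten [seq term_word e.1 ++ term_word e.2 | e <- Gamma].

Lemma size_term_word (S : signature) (t : term S) :
  size (term_word t) = term_size t.
Proof.
elim/term_induction: t => f ts IH /=; congr _.+1.
rewrite size_flatten /shape -map_comp sumnE big_map big_enum /=.
by apply: eq_bigr => i _; apply: IH.
Qed.

Lemma size_eqs_word (S : signature) (Gamma : seq (equation S)) :
  size (eqs_word Gamma) = eqs_size Gamma.
Proof.
rewrite size_flatten /shape -map_comp sumnE big_map.
by apply: eq_bigr => e _; rewrite /= size_cat !size_term_word.
Qed.

(* Main.v *)
Require Import Defs.
From mathcomp Require Import all_boot all_order all_algebra zify.
From mathcomp Require Import boolp.

(** A term congruent to [t] is obtained by rewriting below the root of [t] or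
below the root of a side of an equation congruent to [t]. So an infinite class
yields an infinite walk that alternately replaces a term by a congruent side
and descends to a child with infinite class. It stays among finitely many
vertices, hence runs into a cycle. Conversely, a vertex on a cycle is congruent
to terms that properly contain it, and so to arbitrarily large ones.

For the polynomial time bound, congruence closure and reachability on the
positions of the input word are written as a Datalog program with binary
predicates. The least model of such a program is reached by firing all rules
under all assignments (n+1)^2 q times, where q is the number of predicates.
Loops over assignments are compiled to a multi-tape machine on which a variable
is a head position and a predicate is a set of marks on one memory tape. *)

Set Implicit Arguments.
Unset Strict Implicit.
Unset Printing Implicit Defensive.

(** * While programs on several tapes *)

(** The signature is finite, so only finitely many terms have a given size, and a class is infinite
    exactly when the sizes in it are unbounded. Both halves of the theorem are proved through this
    property, and only for constants, since every term contains one. The decision procedure never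
    builds the quotient graph. Its goal atom says that every constant has an unbounded class. The
    program has no negation, so correctness is a statement about models: the intended reading is a
    model (soundness), and every model contains the required atoms (completeness). The obstacle in
    completeness is that a derivation of a congruence may pass through terms that do not occur in
    the input, while [Eq] only sees positions. It is overcome by extending the relation on occurring
    terms to a congruence on all terms. As the signature is fixed, so are the numbers of rules,
    predicates and variables, hence the number of tapes and the nesting depth of the loops. The
    degree of the polynomial depends on the signature only. *)

Section WhilePrograms.
Variables (k : nat) (A : finType).

Definition symbols : Type := {ffun 'I_k.+1 -> A}.

Inductive cmd :=
| Act of (symbols -> 'I_k.+1 -> A * move)
| Seq of cmd & cmd
| While of (symbols -> bool) & cmd
| If of (symbols -> bool) & cmd & cmd.

(* Head positions and contents of one-way infinite tapes. *)
Definition store : Type := (('I_k.+1 -> nat) * ('I_k.+1 -> nat -> A))%type.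

Definition scan (s : store) : symbols := [ffun i => s.2 i (s.1 i)].

Definition move_pos (d : move) (p : nat) : nat :=
  match d with MoveLeft => p.-1 | Stay => p | MoveRight => p.+1 end.

Definition act_store (a : 'I_k.+1 -> A * move) (s : store) : store :=
  (fun i => move_pos (a i).2 (s.1 i),
   fun i j => if j == s.1 i then (a i).1 else s.2 i j).

Definition legal (a : 'I_k.+1 -> A * move) (s : store) : Prop :=
  forall i, (a i).2 = MoveLeft -> 0 < s.1 i.

Inductive run : cmd -> store -> nat -> store -> Prop :=
| run_act f s : legal (f (scan s)) s ->
    run (Act f) s 1 (act_store (f (scan s)) s)
| run_seq c1 c2 s t1 s1 t2 s2 : run c1 s t1 s1 -> run c2 s1 t2 s2 ->
    run (Seq c1 c2) s (t1 + t2) s2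
| run_while_false (b : symbols -> bool) c s : ~~ b (scan s) ->
    run (While b c) s 1 s
| run_while_true (b : symbols -> bool) c s t1 s1 t2 s2 : b (scan s) ->
    run c s t1 s1 -> run (While b c) s1 t2 s2 ->
    run (While b c) s (1 + t1 + t2) s2
| run_if_true (b : symbols -> bool) c1 c2 s t s' : b (scan s) ->
    run c1 s t s' -> run (If b c1 c2) s (1 + t) s'
| run_if_false (b : symbols -> bool) c1 c2 s t s' : ~~ b (scan s) ->
    run c2 s t s' -> run (If b c1 c2) s (1 + t) s'.

Definition run_within (c : cmd) (s : store) (T : nat) (s' : store) : Prop :=
  exists2 t, t <= T & run c s t s'.

Lemma run_within_leq c s T T' s' :
  T <= T' -> run_within c s T s' -> run_within c s T' s'.
Proof. by move=> TT' [t tT r]; exists t => //; apply: leq_trans TT'. Qed.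

Lemma run_within_act f s s' : legal (f (scan s)) s ->
  s' = act_store (f (scan s)) s -> run_within (Act f) s 1 s'.
Proof. by move=> fs ->; exists 1 => //; apply: run_act. Qed.

Lemma run_within_seq c1 c2 s T1 s1 T2 s2 :
  run_within c1 s T1 s1 -> run_within c2 s1 T2 s2 ->
  run_within (Seq c1 c2) s (T1 + T2) s2.
Proof.
move=> [t1 le1 r1] [t2 le2 r2]; exists (t1 + t2); first exact: leq_add.
exact: run_seq r1 r2.
Qed.

Lemma run_within_if (b : symbols -> bool) c1 c2 s T s' :
  run_within (if b (scan s) then c1 else c2) s T s' ->
  run_within (If b c1 c2) s T.+1 s'.
Proof.
move=> [t le r]; exists t.+1 => //; rewrite -add1n.
by case: ifPn r => bs r; [apply: run_if_true | apply: run_if_false].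
Qed.

(** The store before each round is given as a function of the round, so that an invariant becomes an
    equation. Each of the [n] rounds costs [T] and one step for the test; the remaining step is the
    failing test. *)
Lemma run_within_while (b : symbols -> bool) c T n (s : nat -> store) s0 s' :
  s 0 = s0 -> s n = s' ->
  (forall i, i < n -> b (scan (s i)) /\ run_within c (s i) T (s i.+1)) ->
  ~~ b (scan (s n)) ->
  run_within (While b c) s0 (n * T.+1).+1 s'.
Proof.
move=> <- <- {s0 s'}; elim: n s => [|n IH] s Hs bn.
  by exists 1 => //; apply: run_while_false.
have [b0 [t1 le1 r1]] := Hs 0 isT.
have [||t2 le2 r2] := IH (fun i => s i.+1); [|by []|].
  by move=> i ltin; apply: Hs.
exists (1 + t1 + t2); first by lia.
exact: run_while_true r1 r2.
Qed.

(** * Compilation into a transition table *)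

(** A state is a point of control. The [None] added for loops and conditionals is the point where
    the test is evaluated with the tapes left unchanged; this is the additional step charged in
    [run]. *)
Fixpoint cmd_state (c : cmd) : finType :=
  match c with
  | Act _ => unit
  | Seq c1 c2 => (cmd_state c1 + cmd_state c2)%type
  | While _ c => option (cmd_state c)
  | If _ c1 c2 => option (cmd_state c1 + cmd_state c2)%type
  end.

Fixpoint entry (c : cmd) : cmd_state c :=
  match c with
  | Act _ => tt
  | Seq c1 c2 => inl (entry c1)
  | While _ c => None
  | If _ c1 c2 => None
  end.

Definition stay (s : symbols) : 'I_k.+1 -> A * move := fun i => (s i, Stay).

(* The next state [None] means that the command has terminated. *)
Fixpoint trans (c : cmd) :
    cmd_state c -> symbols -> option (cmd_state c) * ('I_k.+1 -> A * move) :=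
  match c with
  | Act f => fun _ s => (None, f s)
  | Seq c1 c2 => fun q s =>
      match q with
      | inl q1 => let: (o, a) := trans q1 s in
          (Some (if o is Some q then inl q else inr (entry c2)), a)
      | inr q2 => let: (o, a) := trans q2 s in (omap inr o, a)
      end
  | While b c => fun q s =>
      match q with
      | None => (if b s then Some (Some (entry c)) else None, stay s)
      | Some q => let: (o, a) := trans q s in (Some o, a)
      end
  | If b c1 c2 => fun q s =>
      match q with
      | None => (Some (Some (if b s then inl (entry c1) else inr (entry c2))),
                 stay s)
      | Some (inl q1) => let: (o, a) := trans q1 s in
          (omap (Some \o inl) o, a)
      | Some (inr q2) => let: (o, a) := trans q2 s in
          (omap (Some \o inr) o, a)
      end
  end.

Variable blank : A.

Definition tapes : Type := 'I_k.+1 -> tape A.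

Definition heads (T : tapes) : symbols := [ffun i => t_head (T i)].

Definition act_tapes (a : 'I_k.+1 -> A * move) (T : tapes) : tapes :=
  fun i => tape_act blank (a i) (T i).

Inductive steps (c : cmd) : nat -> option (cmd_state c) * tapes ->
    option (cmd_state c) * tapes -> Prop :=
| steps0 X : steps 0 X X
| stepsS n q T Y :
    steps n ((trans q (heads T)).1, act_tapes (trans q (heads T)).2 T) Y ->
    steps n.+1 (Some q, T) Y.

Lemma steps_trans c n m X Y Z :
  @steps c n X Y -> steps m Y Z -> steps (n + m) X Z.
Proof.
move=> XY; elim: XY Z => [//|n' q T Y' _ IH] Z YZ.
by apply/stepsS/IH.
Qed.

(** Simulation of a subcommand: [e] embeds its points of control, and [o'] is where control passes
    once it has terminated. *)
Lemma steps_lift c c' (e : cmd_state c -> cmd_state c') o' :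
  (forall q s, trans (e q) s =
     (if (trans q s).1 is Some q' then Some (e q') else o', (trans q s).2)) ->
  forall n X T', steps n X (None, T') ->
  steps n (if X.1 is Some q then Some (e q) else o', X.2) (o', T').
Proof.
move=> He n X T' r; rewrite -[T']/((@None (cmd_state c), T').2).
have : (@None (cmd_state c), T').1 = None by [].
elim: r => [X' -> | n' q T Y _ IH /IH {}IH] /=; first exact: steps0.
by apply: stepsS; rewrite He.
Qed.

(** On the left only the [p] cells between cell 0 and the head are prescribed: a legal run never
    moves left from cell 0, so a two-way tape can stand for a one-way one. *)
Definition tape_repr (T : tape A) (p : nat) (g : nat -> A) : Prop :=
  [/\ t_head T = g p,
      forall j, j < p -> nth blank (t_left T) j = g (p - j.+1) &
      forall j, nth blank (t_right T) j = g (p + j.+1)].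

Lemma tape_repr_act T p g (a : A * move) :
  tape_repr T p g -> (a.2 = MoveLeft -> 0 < p) ->
  tape_repr (tape_act blank a T) (move_pos a.2 p)
    (fun j => if j == p then a.1 else g j).
Proof.
case: T => l h r [/= eh el er]; case: a => x [] /= pgt;
  [have {}pgt := pgt erefl| |]; split=> //=.
- by rewrite -nth0 el // subn1; case: eqP => //; lia.
- move=> j jp; rewrite nth_behead el; last by lia.
  case: eqP; first by lia.
  by move=> _; congr g; lia.
- case=> [|j] /=; first by case: eqP => //; lia.
  rewrite er; case: eqP; first by lia.
  by move=> _; congr g; lia.
- by rewrite eqxx.
- by move=> j jp; rewrite el //; case: eqP => //; lia.
- by move=> j; rewrite er; case: eqP => //; lia.
- by rewrite -nth0 er addn1; case: eqP => //; lia.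
- case=> [|j] jp /=; first by rewrite subn1 /= eqxx.
  rewrite el; last by lia.
  case: eqP; first by lia.
  by move=> _; congr g; lia.
- move=> j; rewrite nth_behead er; case: eqP; first by lia.
  by move=> _; congr g; lia.
Qed.

Definition tapes_repr (T : tapes) (s : store) : Prop :=
  forall i, tape_repr (T i) (s.1 i) (s.2 i).

Lemma heads_repr T s : tapes_repr T s -> heads T = scan s.
Proof. by move=> Ts; apply/ffunP => i; rewrite !ffunE; case: (Ts i). Qed.

Lemma tapes_repr_stay T s :
  tapes_repr T s -> tapes_repr (act_tapes (stay (heads T)) T) s.
Proof.
move=> Ts i; have [eh el er] := Ts i; rewrite /act_tapes /stay /= !ffunE.
by case: (T i) eh el er.
Qed.

Lemma run_steps c s t s' : run c s t s' -> forall T, tapes_repr T s ->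
  exists2 T', steps t (Some (entry c), T) (None, T') & tapes_repr T' s'.
Proof.
elim=> {c s t s'}.
- move=> f s fs T Ts; exists (act_tapes (f (scan s)) T).
    by apply: stepsS; rewrite /= (heads_repr Ts); apply: steps0.
  by move=> i; apply: tape_repr_act => // /fs.
- move=> c1 c2 s t1 s1 t2 s2 _ IH1 _ IH2 T /IH1[T1 r1 /IH2[T2 r2 Ts2]].
  exists T2 => //;
  apply: (@steps_trans (Seq c1 c2) _ _ _ (Some (inr (entry c2)), T1)).
    apply: (@steps_lift c1 (Seq c1 c2) inl _ _ _ _ _ r1).
    by move=> q s' /=; case: (trans q s') => -[].
  apply: (@steps_lift c2 (Seq c1 c2) inr None _ _ _ _ r2).
  by move=> q s' /=; case: (trans q s') => -[].
- move=> b c s bs T Ts; exists (act_tapes (stay (heads T)) T).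
    apply: stepsS; rewrite /= (heads_repr Ts) (negbTE bs); exact: steps0.
  exact: tapes_repr_stay.
- move=> b c s t1 s1 t2 s2 bs _ IH1 _ IH2 T Ts.
  have /IH1[T1 r1 /IH2[T2 r2 Ts2]] := tapes_repr_stay Ts.
  exists T2 => //; rewrite -addnA; apply: stepsS.
  rewrite /= {1}(heads_repr Ts) bs.
  apply: steps_trans r2.
  apply: (@steps_lift c (While b c) Some (Some None) _ _ _ _ r1).
  by move=> q s' /=; case: (trans q s') => -[].
- move=> b c1 c2 s t s' bs _ IH T Ts.
  have /IH[T1 r1 Ts1] := tapes_repr_stay Ts.
  exists T1 => //; apply: stepsS; rewrite /= {1}(heads_repr Ts) bs.
  apply: (@steps_lift c1 (If b c1 c2) (Some \o inl) None _ _ _ _ r1).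
  by move=> q s1 /=; case: (trans q s1) => -[].
- move=> b c1 c2 s t s' bs _ IH T Ts.
  have /IH[T1 r1 Ts1] := tapes_repr_stay Ts.
  exists T1 => //; apply: stepsS; rewrite /= {1}(heads_repr Ts) (negbTE bs).
  apply: (@steps_lift c2 (If b c1 c2) (Some \o inr) None _ _ _ _ r1).
  by move=> q s1 /=; case: (trans q s1) => -[].
Qed.

Variables (I : finType) (inj : I -> A).

(* The states [inr v] give the verdict [v] of [b] on the final store. *)
Definition cmd_TM (c : cmd) (b : symbols -> bool) : TM I :=
  @MkTM I k A blank inj (option (cmd_state c) + bool)%type
    (inl (Some (entry c)))
    (fun q => if q is inr v then Some v else None)
    (fun q s => match q with
                | inl (Some q) => (inl (trans q s).1, (trans q s).2)
                | inl None => (inr (b s), stay s)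
                | inr v => (inr v, stay s)
                end).

Lemma iter_steps c b n X Y : @steps c n X Y ->
  iter n (@tm_step _ (cmd_TM c b)) (inl X.1, X.2) = (inl Y.1, Y.2).
Proof.
by elim=> [[] // | n' q T Y' _ IH]; rewrite iterSr -IH.
Qed.

Definition init_store (w : seq I) : store :=
  (fun _ => 0,
   fun i => nth blank (if i == ord0 then map inj w else [::])).

Lemma cmd_TM_answers c b w T s' :
  run_within c (init_store w) T s' ->
  tm_answers_within (cmd_TM c b) w T.+1 (b (scan s')).
Proof.
move=> [t tT /run_steps r].
have [|T' rT' Ts'] := r (tm_init (cmd_TM c b) w).2.
  move=> i; rewrite /tm_init /=; by split=> //= j; rewrite nth_behead.
exists t.+1 => //; rewrite iterS (iter_steps b rT') /tm_step /=.
by rewrite -(heads_repr Ts').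
Qed.

End WhilePrograms.
(** * Polynomial bounds *)

Definition poly_bounded (T : nat -> nat) : Prop :=
  exists p : {poly nat}, forall n, T n <= p.[n]%R.

Lemma poly_bounded_leq T T' :
  (forall n, T n <= T' n) -> poly_bounded T' -> poly_bounded T.
Proof.
by move=> TT' [p Hp]; exists p => n; apply: leq_trans (TT' n) (Hp n).
Qed.

Lemma poly_bounded_const c : poly_bounded (fun _ => c).
Proof. by exists (c%:P)%R => n; rewrite hornerC. Qed.

Lemma poly_bounded_id : poly_bounded id.
Proof. by exists 'X%R => n; rewrite hornerX. Qed.

Lemma poly_bounded_add T T' : poly_bounded T -> poly_bounded T' ->
  poly_bounded (fun n => T n + T' n).
Proof.
move=> [p Hp] [q Hq]; exists (p + q)%R => n; rewrite hornerD.
exact: leq_add (Hp n) (Hq n).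
Qed.

Lemma poly_bounded_mul T T' : poly_bounded T -> poly_bounded T' ->
  poly_bounded (fun n => T n * T' n).
Proof.
move=> [p Hp] [q Hq]; exists (p * q)%R => n; rewrite hornerM.
exact: leq_mul (Hp n) (Hq n).
Qed.

Lemma poly_bounded_S T : poly_bounded T -> poly_bounded (fun n => (T n).+1).
Proof.
move=> HT; apply: (@poly_bounded_leq _ (fun n => T n + 1)) => [n|].
  by rewrite addn1.
exact/poly_bounded_add/poly_bounded_const.
Qed.

(** * Datalog programs over words *)

(** Defined by recursion so that on an explicit list, such as the body of a rule, it computes to a
    conjunction. *)
Fixpoint Forall (T : Type) (P : T -> Prop) (s : seq T) : Prop :=
  if s is x :: s' then P x /\ Forall P s' else True.

Section Forall.
Variables (T : Type) (P : T -> Prop).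

Lemma Forall_cat s1 s2 : Forall P (s1 ++ s2) <-> Forall P s1 /\ Forall P s2.
Proof. by elim: s1 => [|x s1 IH] /=; [tauto | rewrite IH; tauto]. Qed.

Lemma Forall_flatten ss : Forall P (flatten ss) <-> Forall (Forall P) ss.
Proof. by elim: ss => //= s ss IH; rewrite Forall_cat IH. Qed.

Lemma Forall_map (U : Type) (f : U -> T) s :
  Forall P (map f s) <-> Forall (fun x => P (f x)) s.
Proof. by elim: s => //= x s ->. Qed.

End Forall.

Lemma Forall_in (T : eqType) (P : T -> Prop) (s : seq T) :
  Forall P s <-> {in s, forall x, P x}.
Proof.
elim: s => [//|x s IH] /=; split.
  by move=> [Px /IH Ps] y /[!inE]/predU1P[->|/Ps].
move=> Ps; split; first by apply: Ps; rewrite mem_head.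
by apply/IH => y ys; apply: Ps; rewrite inE ys orbT.
Qed.

Lemma Forall_enum (T : finType) (P : T -> Prop) :
  Forall P (enum T) <-> forall x, P x.
Proof.
by rewrite Forall_in; split=> Ps x; [apply: Ps; rewrite mem_enum | move=> _].
Qed.

Section Datalog.
Variables (I Q : finType).

(* Variables are numbers and range over the positions [0, ..., size w] of the
   word [w]. [Rel s q a b] is the atom R_q(x_a + s, x_b). *)
Inductive atom :=
| Rel of bool & Q & nat & nat
| Sym of nat & I
| Zero of nat.

Inductive rule := Rule of seq atom & Q & nat & nat.

Definition letter (w : seq I) (j : nat) : option I := nth None (map Some w) j.

Lemma letterN w j : (letter w j == None) = (size w <= j).
Proof.
rewrite /letter; case: (leqP (size w) j) => jw.
  by rewrite nth_default ?size_map.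
by case: w jw => // a w jw; rewrite (nth_map a).
Qed.

Definition atom_holds (w : seq I) (R : Q -> nat -> nat -> Prop)
    (x : nat -> nat) (a : atom) : Prop :=
  match a with
  | Rel s q a b => R q (s + x a) (x b)
  | Sym a f => letter w (x a) = Some f
  | Zero a => x a = 0
  end.

Definition closed_rule (w : seq I) (R : Q -> nat -> nat -> Prop)
    (r : rule) : Prop :=
  let: Rule l q a b := r in
  forall x : nat -> nat, (forall v, x v <= size w) ->
    Forall (atom_holds w R x) l -> R q (x a) (x b).

Definition memory : Type := nat -> {set Q}.

(** Row-major coding of pairs, injective for [j <= size w]. A shifted atom may look into row
    [(size w).+1], which stays empty because heads of rules are not shifted. *)
Definition mem_rel (w : seq I) (m : memory) (q : Q) (i j : nat) : bool :=
  q \in m (i * (size w).+1 + j).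

Definition atomb (w : seq I) (m : memory) (x : nat -> nat) (a : atom) : bool :=
  match a with
  | Rel s q a b => mem_rel w m q (s + x a) (x b)
  | Sym a f => letter w (x a) == Some f
  | Zero a => x a == 0
  end.

Lemma atombP w m x a : atomb w m x a <-> atom_holds w (mem_rel w m) x a.
Proof. by case: a => //= *; split=> /eqP. Qed.

Definition add_bit (p : nat) (q : Q) (m : memory) : memory :=
  fun p' => if p' == p then q |: m p' else m p'.

Definition fire (w : seq I) (x : nat -> nat) (m : memory) (r : rule) : memory :=
  let: Rule l q a b := r in
  if all (atomb w m x) l then add_bit (x a * (size w).+1 + x b) q m else m.

Definition atom_vars (a : atom) : seq nat :=
  match a with Rel _ _ a b => [:: a; b] | Sym a _ => [:: a] | Zero a => [:: a]
  end.

Definition rule_vars (r : rule) : seq nat :=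
  let: Rule l _ a b := r in a :: b :: flatten (map atom_vars l).

(** This is what allows finitely many tape heads to represent an assignment to all variables. *)
Lemma eq_fire w x y m r : {in rule_vars r, x =1 y} ->
  fire w x m r = fire w y m r.
Proof.
case: r => l q a b /= xy.
have -> : x a = y a by apply: xy; rewrite mem_head.
have -> : x b = y b by apply: xy; rewrite !inE eqxx orbT.
suff -> : all (atomb w m x) l = all (atomb w m y) l by [].
have {}xy : {in flatten (map atom_vars l), x =1 y}.
  by move=> v vl; apply: xy; rewrite !inE vl !orbT.
elim: l xy => //= c l IH xy; rewrite IH; last first.
  by move=> v vl; apply: xy; rewrite mem_cat vl orbT.
congr andb; have {}xy : {in atom_vars c, x =1 y}.
  by move=> v vl; apply: xy; rewrite mem_cat vl.
by case: c xy => [s r u v|u f|u] /= xy; rewrite !xy ?inE ?eqxx ?orbT.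
Qed.

(** ** Programs on tapes *)

Section Machine.
Variable K : nat.

(** Tape 0 carries the input and later measures rows, tape 1 is the memory, tape 2 saves a value
    while another head is consumed. Tapes 3 and 4 count rounds, and the head of tape [5 + v] is the
    value of variable [v]. *)
Definition tp (i : nat) : 'I_(K + 4).+1 := inord i.
Definition Walk := tp 0.
Definition Mem := tp 1.
Definition Aux := tp 2.
Definition var (v : nat) : 'I_(K + 4).+1 := tp (5 + v).

Lemma tp_eq i j : i <= K + 4 -> j <= K + 4 -> (tp i == tp j) = (i == j).
Proof. by move=> iK jK; rewrite -val_eqE /= !inordK. Qed.

Definition cell : finType := (option I * bool * {set Q})%type.

Local Notation cmd := (cmd (K + 4) cell).
Local Notation pos := ('I_(K + 4).+1 -> nat).
Local Notation store := (store (K + 4) cell).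
Local Notation symbols := (symbols (K + 4) cell).

(* Each tape carries a copy of [w] and a mark on cell 0; only the third
   component of [Mem] is ever modified. *)
Definition cfg (w : seq I) (x : pos) (m : memory) : store :=
  (x, fun i j => (letter w j, j == 0, if i == Mem then m j else set0)).

Definition upd (x : pos) i v : pos := fun j => if j == i then v else x j.

Definition mv (d : 'I_(K + 4).+1 -> move) : cmd := Act (fun s i => (s i, d i)).

Lemma run_mv w m d (x y : pos) :
  (forall i, d i = MoveLeft -> 0 < x i) ->
  (forall i, y i = move_pos (d i) (x i)) ->
  run_within (mv d) (cfg w x m) 1 (cfg w y m).
Proof.
move=> dx yx; apply: run_within_act; first exact: dx.
rewrite /act_store /cfg /=; congr pair; first exact/funext.
apply/funext => i; apply/funext => j; case: (j =P x i) => //= ->.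
by rewrite ffunE.
Qed.

Definition marked i (s : symbols) : bool := (s i).1.2.
Definition at_end i (s : symbols) : bool := (s i).1.1 == None.

Lemma marked_cfg w x m i : marked i (scan (cfg w x m)) = (x i == 0).
Proof. by rewrite /marked ffunE. Qed.

Lemma at_end_cfg w x m i : at_end i (scan (cfg w x m)) = (size w <= x i).
Proof. by rewrite /at_end ffunE /= letterN. Qed.

Definition skip : cmd := mv (fun _ => Stay).

Lemma run_skip w x m : run_within skip (cfg w x m) 1 (cfg w x m).
Proof. exact: run_mv. Qed.

Definition right i : cmd := mv (fun j => if j == i then MoveRight else Stay).

Lemma run_right w x m i :
  run_within (right i) (cfg w x m) 1 (cfg w (upd x i (x i).+1) m).
Proof.
apply: run_mv => j; first by case: ifP.
by rewrite /upd; case: eqP => [->|].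
Qed.

Definition rewind i : cmd :=
  While (fun s => ~~ marked i s)
    (mv (fun j => if j == i then MoveLeft else Stay)).

Lemma upd_id x i v : v = x i -> upd x i v = x.
Proof. by move=> ->; apply/funext => j; rewrite /upd; case: eqP => [->|]. Qed.

Lemma upd_same x i v : upd x i v i = v.
Proof. by rewrite /upd eqxx. Qed.

Lemma upd_upd x i u v : upd (upd x i u) i v = upd x i v.
Proof. by apply/funext => j; rewrite /upd; case: eqP. Qed.

Lemma run_rewind w x m i :
  run_within (rewind i) (cfg w x m) (x i * 2).+1 (cfg w (upd x i 0) m).
Proof.
apply: (@run_within_while _ _ _ _ 1 (x i)
  (fun t => cfg w (upd x i (x i - t)) m)).
- by rewrite subn0 upd_id.
- by rewrite subnn.
- move=> t tx; rewrite marked_cfg /upd eqxx -lt0n subn_gt0; split=> //.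
  by apply: run_mv => j; case: (j == i) => //=; lia.
- by rewrite negbK marked_cfg /upd eqxx subnn.
Qed.

(** Adds [(size w).+1] to the position of [Mem]: [Walk] runs over its copy of the word in parallel
    with [Mem], and one more move to the right gives the successor. *)
Definition row : cmd :=
  Seq (While (fun s => ~~ at_end Walk s)
         (mv (fun j => if (j == Walk) || (j == Mem) then MoveRight else Stay)))
      (Seq (right Mem) (rewind Walk)).

Lemma Mem_Walk : (Mem == Walk) = false.
Proof. by rewrite tp_eq // addn4. Qed.

Lemma run_row w x m : x Walk = 0 ->
  run_within row (cfg w x m) (4 * (size w).+1)
    (cfg w (upd x Mem (x Mem + (size w).+1)) m).
Proof.
move=> x0; pose n := size w.
pose xt t := upd (upd x Walk t) Mem (x Mem + t).
apply: (@run_within_leq _ _ _ _ ((n * 2).+1 + (1 + (n * 2).+1))).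
  by rewrite /n; lia.
apply: (@run_within_seq _ _ _ _ _ _ (cfg w (xt n) m)).
  apply: (@run_within_while _ _ _ _ 1 n (fun t => cfg w (xt t) m)) => //.
  - by rewrite /xt addn0 (@upd_id x Walk) ?upd_id ?x0.
    move=> t tn; rewrite at_end_cfg {1}/xt /upd eq_sym Mem_Walk eqxx -ltnNge.
    split=> //; apply: run_mv => j; first by case: ifP.
    rewrite /xt /upd; case: (eqVneq j Mem) => [->|_].
      by rewrite orbT addnS.
    by rewrite orbF; case: eqP.
  by rewrite negbK at_end_cfg {1}/xt /upd eq_sym Mem_Walk eqxx leqnn.
apply: run_within_seq (run_right _ _ _ _) _.
set y := upd (xt n) Mem _.
have yW : y Walk = n by rewrite /y /xt /upd eq_sym Mem_Walk eqxx.
have -> : upd x Mem (x Mem + n.+1) = upd y Walk 0.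
  apply/funext => j; rewrite /y /xt /upd eqxx.
  case: (eqVneq j Mem) => [->|_]; first by rewrite Mem_Walk addnS.
  by case: eqP => // ->.
by have := run_rewind w y m Walk; rewrite yW.
Qed.

(** Repeated addition. The head of [a] is consumed as the counter, so the head of [u] counts up to
    save its value; a second transfer with [skip] restores it. *)
Definition transfer a u (c : cmd) : cmd :=
  While (fun s => ~~ marked a s)
    (Seq (mv (fun j => if j == a then MoveLeft
                       else if j == u then MoveRight else Stay)) c).

Lemma run_transfer w x m a u c e T :
  uniq [:: Walk; Mem; a; u] ->
  (forall y, y Walk = 0 -> run_within c (cfg w y m) T
     (cfg w (upd y Mem (y Mem + e)) m)) ->
  x Walk = 0 ->
  run_within (transfer a u c) (cfg w x m) (x a * T.+2).+1
    (cfg w (upd (upd (upd x a 0) u (x u + x a)) Mem (x Mem + x a * e)) m).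
Proof.
rewrite /= !inE !negb_or andbT -!andbA => /and5P[WM Wa Wu Ma /andP[Mu au]].
move=> Hc x0.
pose xt t := upd (upd (upd x a (x a - t)) u (x u + t)) Mem (x Mem + t * e).
have xta t : xt t a = x a - t.
  by rewrite /xt /upd (negbTE au) eqxx [a == Mem]eq_sym (negbTE Ma).
apply: (@run_within_while _ _ _ _ T.+1 (x a) (fun t => cfg w (xt t) m)).
- by rewrite /xt subn0 !addn0 !upd_id.
- by rewrite /xt subnn.
2: by rewrite negbK marked_cfg xta subnn.
move=> t ta; rewrite marked_cfg xta -lt0n subn_gt0; split=> //.
rewrite -[T.+1]add1n; pose y := upd (xt t.+1) Mem (xt t Mem).
apply: (@run_within_seq _ _ _ _ _ _ (cfg w y m)).
  apply: run_mv => j.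
    by case: eqP => [-> _|]; [rewrite xta subn_gt0 | case: ifP].
  rewrite /y /upd; case: (eqVneq j Mem) => [->|jM].
    by rewrite (negbTE Ma) (negbTE Mu).
  case: (eqVneq j a) => [->|ja]; first by rewrite !xta subnS.
  rewrite /xt /upd (negbTE jM) (negbTE ja).
  by case: (eqVneq j u) => //= _; rewrite addnS.
have -> : xt t.+1 = upd y Mem (y Mem + e).
  rewrite /y upd_upd; apply/funext => j; rewrite /xt /upd eqxx.
  by case: eqP => //= _; lia.
apply: Hc; rewrite /y /xt /upd (negbTE Wu) (negbTE Wa) (negbTE WM) x0.
by [].
Qed.

(* Moves the head of [Mem] to the cell of R(x_a + s, x_b), see [mem_rel]. *)
Definition seek (s : bool) a b : cmd :=
  Seq (if s then row else skip)
  (Seq (transfer a Aux row) (Seq (transfer Aux a skip)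
  (Seq (transfer b Aux (right Mem)) (transfer Aux b skip)))).

(** The parts of [seek] add up to at most 4n^2 + 19n + 8 steps; the constant is a generous
    choice. *)
Definition seek_time n := 25 * (n.+1 * n.+1).

Lemma run_seek w x m s a b :
  uniq [:: Walk; Mem; a; Aux] -> uniq [:: Walk; Mem; b; Aux] ->
  x Walk = 0 -> x Mem = 0 -> x Aux = 0 -> x a <= size w -> x b <= size w ->
  run_within (seek s a b) (cfg w x m) (seek_time (size w))
    (cfg w (upd x Mem ((s + x a) * (size w).+1 + x b)) m).
Proof.
set n := size w; move=> ua ub xW xM xA xan xbn.
apply: (@run_within_leq _ _ _ _ (4 * n.+1 + ((x a * (4 * n.+1).+2).+1 +
    ((x a * 3).+1 + ((x b * 3).+1 + (x b * 3).+1))))).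
  by rewrite /seek_time; nia.
pose x1 := upd x Mem (s * n.+1).
have ua' : uniq [:: Walk; Mem; Aux; a].
  by rewrite -(perm_uniq (s1 := [:: Walk; Mem; a; Aux])) // !perm_cons
    (permEl (perm_catC [:: a] [:: Aux])).
have ub' : uniq [:: Walk; Mem; Aux; b].
  by rewrite -(perm_uniq (s1 := [:: Walk; Mem; b; Aux])) // !perm_cons
    (permEl (perm_catC [:: b] [:: Aux])).
have skipP y : y Walk = 0 -> run_within skip (cfg w y m) 1
    (cfg w (upd y Mem (y Mem + 0)) m).
  by move=> _; rewrite addn0 upd_id //; apply: run_skip.
move: (ua); rewrite /= !inE !negb_or andbT -!andbA.
move=> /and5P[WM Wa WA Ma /andP[MA aA]].
move: (ub); rewrite /= !inE !negb_or andbT -!andbA.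
move=> /and5P[_ Wb _ Mb /andP[_ bA]].
pose W0 y := y Walk = 0 :> nat.
have W0upd y i v : W0 y -> Walk != i -> W0 (upd y i v).
  by rewrite /W0 /upd => yW /negbTE ->.
have W1 : W0 x1 by apply: (W0upd).
apply: (@run_within_seq _ _ _ _ _ _ (cfg w x1 m)).
  case: (s) @x1 W1 => x1 W1.
    by rewrite /x1 mul1n; have := @run_row w x m xW; rewrite xM.
  apply: (@run_within_leq _ _ _ _ 1) => //.
  by rewrite /x1 mul0n upd_id //; apply: run_skip.
pose x2 := upd (upd x1 Aux (x a)) Mem ((s + x a) * n.+1).
have x1a : x1 a = x a by rewrite /x1 /upd eq_sym (negbTE Ma).
have x1b : x1 b = x b by rewrite /x1 /upd eq_sym (negbTE Mb).
have x1A : x1 Aux = 0 by rewrite /x1 /upd eq_sym (negbTE MA).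
have x1M : x1 Mem = s * n.+1 by rewrite /x1 /upd eqxx.
apply: run_within_seq.
  have := @run_transfer w x1 m a Aux row n.+1 _ ua _ W1; rewrite x1a; apply.
  by move=> y; apply: run_row.
set y2 := upd (upd _ _ _) _ _.
have y2A : y2 Aux = x a.
  by rewrite /y2 /upd eq_sym (negbTE MA) eqxx x1A.
have y2M : y2 Mem = (s + x a) * n.+1.
  by rewrite /y2 /upd eqxx x1M mulnDl.
have y2a : y2 a = 0.
  by rewrite /y2 /upd eq_sym (negbTE Ma) (negbTE aA) eqxx.
have W2 : W0 y2 by do 3 apply: (W0upd) => //.
apply: run_within_seq.
  by have := @run_transfer w y2 m Aux a skip 0 1 ua' skipP W2; rewrite y2A;
    apply.
have -> : upd (upd (upd y2 Aux 0) a (y2 a + x a)) Mem (y2 Mem + x a * 0)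
    = upd x Mem ((s + x a) * n.+1).
  rewrite y2a y2M muln0 addn0; apply/funext => j; rewrite /y2 /x1 /upd.
  case: (eqVneq j Mem) => // jM; case: (eqVneq j a) => [->//|ja].
  by case: (eqVneq j Aux) => // ->.
set x3 := upd x Mem _.
have W3 : W0 x3 by apply: (W0upd).
have x3b : x3 b = x b by rewrite /x3 /upd eq_sym (negbTE Mb).
have x3A : x3 Aux = 0 by rewrite /x3 /upd eq_sym (negbTE MA).
have x3M : x3 Mem = (s + x a) * n.+1 by rewrite /x3 /upd eqxx.
apply: run_within_seq.
  have := @run_transfer w x3 m b Aux (right Mem) 1 1 ub _ W3; rewrite x3b.
  by apply => y _; rewrite addn1; apply: run_right.
set y4 := upd (upd _ _ _) _ _.
have y4A : y4 Aux = x b.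
  by rewrite /y4 /upd eq_sym (negbTE MA) eqxx x3A.
have y4M : y4 Mem = (s + x a) * n.+1 + x b.
  by rewrite /y4 /upd eqxx x3M muln1.
have y4b : y4 b = 0.
  by rewrite /y4 /upd eq_sym (negbTE Mb) (negbTE bA) eqxx.
have W4 : W0 y4 by do 3 apply: (W0upd) => //.
have := @run_transfer w y4 m Aux b skip 0 1 ub' skipP W4; rewrite y4A.
suff -> : upd (upd (upd y4 Aux 0) b (y4 b + x b)) Mem (y4 Mem + x b * 0)
    = upd x Mem ((s + x a) * n.+1 + x b) by [].
rewrite y4b y4M muln0 addn0; apply/funext => j; rewrite /y4 /x3 /upd.
case: (eqVneq j Mem) => // jM; case: (eqVneq j b) => [->//|jb].
by case: (eqVneq j Aux) => // ->.
Qed.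

Definition write (q : Q) : cmd :=
  Act (fun s i => (if i == Mem then ((s i).1, q |: (s i).2) else s i, Stay)).

Lemma run_write w x m q :
  run_within (write q) (cfg w x m) 1 (cfg w x (add_bit (x Mem) q m)).
Proof.
apply: run_within_act => //; rewrite /act_store /cfg /=; congr pair.
apply/funext => i; apply/funext => j; rewrite /add_bit.
case: (eqVneq i Mem) => [->|iM].
  by case: (eqVneq j (x Mem)) => //= ->; rewrite ffunE /= eqxx.
by case: (eqVneq j (x i)) => //= ->; rewrite ffunE /= (negbTE iM).
Qed.

Definition has_bit (q : Q) (s : symbols) : bool := q \in (s Mem).2.

Definition reads i (f : I) (s : symbols) : bool := (s i).1.1 == Some f.

(** A conjunction becomes nested conditionals. Every branch rewinds [Mem], so each atom is tested
    from a store with the same head positions. *)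
Fixpoint fire_cmd (l : seq atom) (q : Q) (a b : nat) : cmd :=
  match l with
  | [::] => Seq (seek false (var a) (var b)) (Seq (write q) (rewind Mem))
  | Zero c :: l' => If (marked (var c)) (fire_cmd l' q a b) skip
  | Sym c f :: l' =>
      If (reads (var c) f) (fire_cmd l' q a b) skip
  | Rel s p c d :: l' =>
      Seq (seek s (var c) (var d))
        (If (has_bit p)
           (Seq (rewind Mem) (fire_cmd l' q a b)) (rewind Mem))
  end.

Definition valid (w : seq I) (x : pos) : Prop :=
  [/\ x Walk = 0, x Mem = 0, x Aux = 0 & forall i, x i <= size w].

Lemma uniq_var v : v < K -> uniq [:: Walk; Mem; var v; Aux].
Proof. by move=> vK; rewrite /= !inE !tp_eq //; lia. Qed.

(** Leaves room for one [seek] and for rewinding [Mem] from a cell below (n+1)(n+2). *)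
Definition fire_time n := 40 * (n.+1 * n.+1).

Lemma run_seek_rewind w x m (s : bool) a b T c m' :
  a < K -> b < K -> valid w x ->
  run_within c (cfg w (upd x Mem ((s + x (var a)) * (size w).+1 + x (var b))) m)
    (T + 2 * ((s + x (var a)) * (size w).+1 + x (var b)).+1) (cfg w x m') ->
  run_within (Seq (seek s (var a) (var b)) c) (cfg w x m)
    (fire_time (size w) + T) (cfg w x m').
Proof.
move=> aK bK [x0 x1 x2 xn] Hc.
have xa := xn (var a); have xb := xn (var b).
have H := @run_seek w x m s (var a) (var b) (uniq_var aK) (uniq_var bK)
  x0 x1 x2 xa xb.
apply: run_within_leq (run_within_seq H Hc).
rewrite /seek_time /fire_time; case: s {H Hc} => /=; nia.
Qed.

Lemma run_fire w x m l q a b : valid w x ->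
  all (fun v => v < K) (rule_vars (Rule l q a b)) ->
  run_within (fire_cmd l q a b) (cfg w x m)
    ((size l).+1 * (fire_time (size w)).+3)
    (cfg w x (fire w (fun v => x (var v)) m (Rule l q a b))).
Proof.
move=> vx /=; set T := fire_time _.
have rewindP m' p : run_within (rewind Mem) (cfg w (upd x Mem p) m')
    (2 * p.+1) (cfg w x m').
  have := @run_rewind w (upd x Mem p) m' Mem.
  rewrite upd_upd (@upd_id x Mem 0); last by case: vx => _ ->.
  by rewrite /upd eqxx; apply: run_within_leq; lia.
move=> /and3P[aK bK]; elim: l => [|c l IH] /=.
  move=> _; apply: (@run_within_leq _ _ _ _ (T + 1)); first by lia.
  apply: run_seek_rewind => //.
  apply: run_within_seq (rewindP _ _).
  rewrite add0n; set p := x (var a) * _ + _.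
  have := @run_write w (upd x Mem p) m q.
  by have -> : upd x Mem p Mem = p by rewrite /upd eqxx.
rewrite all_cat => /andP[cK /IH{}IH]; rewrite mulSn.
case: c cK => [s r u v|u f|u] /= cK.
- have /and3P[uK vK _] := cK; rewrite -[in T.+3 + _]addn3 -addnA.
  apply: run_seek_rewind => //.
  set p := (s + _) * _ + _.
  apply: (@run_within_leq _ _ _ _ (2 + (size l).+1 * T.+3 + 2 * p.+1).+1).
    by lia.
  apply: run_within_if.
  rewrite /has_bit ffunE /= eqxx /upd eqxx /mem_rel -/p.
  case: ifP => _ /=.
    by apply: run_within_leq (run_within_seq (rewindP _ _) IH); lia.
  by apply: run_within_leq (rewindP _ _); lia.
- apply: (@run_within_leq _ _ _ _ ((size l).+1 * T.+3 + 1).+1); first by lia.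
  apply: run_within_if; rewrite /reads ffunE /=.
  case: ifP => _ /=; first by apply: run_within_leq IH; lia.
  by apply: run_within_leq (run_skip _ _ _); lia.
- apply: (@run_within_leq _ _ _ _ ((size l).+1 * T.+3 + 1).+1); first by lia.
  apply: run_within_if; rewrite marked_cfg.
  case: ifP => _ /=; first by apply: run_within_leq IH; lia.
  by apply: run_within_leq (run_skip _ _ _); lia.
Qed.

(** ** Loops *)

(** The heads in [l] are the loop counters of [c]. They have to be at 0 at the start, and they are
    again at 0 at the end, since all positions are restored; hence such commands can be nested and
    repeated. *)
Definition implements (l : seq 'I_(K + 4).+1) (c : cmd)
    (F : seq I -> pos -> memory -> memory) : Prop :=
  exists2 T, poly_bounded T & forall w x m, valid w x ->
    {in l, forall i, x i = 0} ->
    run_within c (cfg w x m) (T (size w)) (cfg w x (F w x m)).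

Lemma implements_skip l : implements l skip (fun _ _ m => m).
Proof.
exists (fun _ => 1) => [|w x m _ _]; first exact: poly_bounded_const.
exact: run_skip.
Qed.

Lemma implements_seq l c1 c2 F1 F2 : implements l c1 F1 -> implements l c2 F2 ->
  implements l (Seq c1 c2) (fun w x m => F2 w x (F1 w x m)).
Proof.
move=> [T1 p1 H1] [T2 p2 H2]; exists (fun n => T1 n + T2 n).
  exact: poly_bounded_add.
move=> w x m vx lx.
exact: run_within_seq (H1 _ _ _ vx lx) (H2 _ _ _ vx lx).
Qed.

Definition repeat_cmd k (c : cmd) : cmd := iter k (fun d => Seq d c) skip.

Lemma implements_repeat l c F k : implements l c F ->
  implements l (repeat_cmd k c) (fun w x m => iter k (F w x) m).
Proof.
move=> H; elim: k => [|k]; first exact: implements_skip.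
by move/implements_seq; apply.
Qed.

Definition rules_cmd (rs : seq rule) : cmd :=
  foldr (fun r c => let: Rule l q a b := r in Seq (fire_cmd l q a b) c) skip rs.

Definition fire_all (rs : seq rule) w (x : pos) (m : memory) : memory :=
  foldl (fire w (fun v => x (var v))) m rs.

Lemma poly_bounded_fire_time : poly_bounded fire_time.
Proof.
have S := poly_bounded_S poly_bounded_id.
exact: poly_bounded_mul (poly_bounded_const _) (poly_bounded_mul S S).
Qed.

Lemma implements_rules l rs :
  all (fun v => v < K) (flatten (map rule_vars rs)) ->
  implements l (rules_cmd rs) (fire_all rs).
Proof.
elim: rs => [|r rs IH] /=; first by move=> _; apply: implements_skip.
rewrite all_cat => /andP[rK /IH{}IH].
case: r rK => l' q a b rK.
apply: (@implements_seq _ _ _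
  (fun w x m => fire w (fun v => x (var v)) m (Rule l' q a b))) IH.
exists (fun n => (size l').+1 * (fire_time n).+3) => [|w x m vx _].
  apply: poly_bounded_mul; first exact: poly_bounded_const.
  by do 3 apply: poly_bounded_S; apply: poly_bounded_fire_time.
exact: run_fire.
Qed.

(** The range includes the end position [size w], where the loop test already fails. Hence the
    further copy of [c] after the loop. *)
Definition for_cmd i (c : cmd) : cmd :=
  Seq (While (fun s => ~~ at_end i s) (Seq c (right i))) (Seq c (rewind i)).

Definition loop (F : seq I -> pos -> memory -> memory) i w (x : pos) m :=
  foldl (fun m v => F w (upd x i v) m) m (iota 0 (size w).+1).

Lemma foldl_iotaS (T : Type) (f : T -> nat -> T) z n :
  foldl f z (iota 0 n.+1) = f (foldl f z (iota 0 n)) n.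
Proof. by rewrite -addn1 iotaD foldl_cat. Qed.

Lemma implements_for i l c F :
  i \notin [:: Walk; Mem; Aux] -> i \notin l -> implements l c F ->
  implements (i :: l) (for_cmd i c) (loop F i).
Proof.
rewrite !inE !negb_or => /and3P[iW iM iA] il [T pT HT].
exists (fun n => (n * (T n).+2).+1 + (T n + (n * 2).+1)) => [|w x m vx lx].
  apply: poly_bounded_add.
    apply/poly_bounded_S/poly_bounded_mul; first exact: poly_bounded_id.
    by do 2 apply: poly_bounded_S.
  apply: poly_bounded_add => //.
  exact/poly_bounded_S/poly_bounded_mul/poly_bounded_const/poly_bounded_id.
set n := size w.
pose mt t := foldl (fun m v => F w (upd x i v) m) m (iota 0 t).
have xi : x i = 0 by apply: lx; rewrite mem_head.
have body t : t <= n -> run_within c (cfg w (upd x i t) (mt t)) (T n)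
    (cfg w (upd x i t) (mt t.+1)).
  move=> tn; rewrite /mt foldl_iotaS; apply: HT.
    case: vx => x0 x1 x2 xn; split; rewrite /upd.
    - by rewrite eq_sym (negbTE iW).
    - by rewrite eq_sym (negbTE iM).
    - by rewrite eq_sym (negbTE iA).
    - by move=> j; case: ifP.
  move=> j jl; rewrite /upd; case: eqP => [ji|_].
    by rewrite -ji jl in il.
  by apply: lx; rewrite inE jl orbT.
apply: (@run_within_seq _ _ _ _ _ _ (cfg w (upd x i n) (mt n))).
  apply: (@run_within_while _ _ _ _ (T n).+1 n
    (fun t => cfg w (upd x i t) (mt t))) => //.
  - by rewrite upd_id.
  - move=> t tn; rewrite at_end_cfg /upd eqxx -ltnNge; split=> //.
    rewrite -[(T n).+1]addn1; apply: run_within_seq (body _ (ltnW tn)) _.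
    by have := @run_right w (upd x i t) (mt t.+1) i; rewrite upd_upd upd_same.
  - by rewrite negbK at_end_cfg /upd eqxx.
apply: run_within_seq (body _ (leqnn _)) _.
have := @run_rewind w (upd x i n) (mt n.+1) i.
rewrite upd_upd upd_same.
by rewrite (@upd_id x i 0) ?xi.
Qed.

Definition for_all_cmd (l : seq 'I_(K + 4).+1) (c : cmd) : cmd :=
  foldr for_cmd c l.

Definition loops (F : seq I -> pos -> memory -> memory) l :=
  foldr (fun i F => loop F i) F l.

Lemma implements_for_all l l' c F :
  all (fun i => i \notin [:: Walk; Mem; Aux]) l -> uniq (l ++ l') ->
  implements l' c F -> implements (l ++ l') (for_all_cmd l c) (loops F l).
Proof.
move=> + + H; elim: l => //= i l IH /andP[iW /IH{}IH] /andP[il /IH].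
exact: implements_for.
Qed.

(** ** Initialisation *)

Definition blank_cell : cell := (None, false, set0).
Definition input_cell (a : I) : cell := (Some a, false, set0).

(** All heads move in lockstep, so the letter under [Walk] can be copied to every tape. The mark put
    on cell 0 at the start stops the way back. *)
Definition init_cmd : cmd :=
  Seq (Act (fun s _ => (((s Walk).1.1, true, set0), Stay)))
  (Seq (While (fun s => ~~ at_end Walk s)
     (Seq (mv (fun _ => MoveRight))
          (Act (fun s _ => (((s Walk).1.1, false, set0), Stay)))))
  (While (fun s => ~~ marked Walk s) (mv (fun _ => MoveLeft)))).

Lemma run_init w :
  run_within init_cmd (init_store (K + 4) blank_cell input_cell w)
    (1 + ((size w * 3).+1 + (size w * 2).+1))
    (cfg w (fun _ => 0) (fun _ => set0)).
Proof.
set n := size w.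
pose orig (i : 'I_(K + 4).+1) :=
  nth blank_cell (if i == ord0 then map input_cell w else [::]).
have origW j : (orig Walk j).1.1 = letter w j.
  have -> : orig Walk = nth blank_cell (map input_cell w).
    by rewrite /orig /Walk /tp -val_eqE /= inordK.
  rewrite /letter; elim: (w) j => [|a w' IH] [|j] //=.
have orig_end i j : n <= j -> orig i j = blank_cell.
  by move=> nj; rewrite /orig; case: ifP => _; rewrite nth_default ?size_map.
(* All heads are at [t], and the cells up to [t'] have been rewritten. *)
pose st t t' : store := (fun _ => t, fun i j =>
  if j <= t' then (letter w j, j == 0, set0) else orig i j).
have st_n t : st t n = cfg w (fun _ => t) (fun _ => set0).
  congr pair; apply/funext => i; apply/funext => j; case: leqP => jn.
    by case: ifP.
  rewrite orig_end ?(ltnW jn) //.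
  have /eqP -> : letter w j == None by rewrite letterN ltnW.
  by case: ifP; rewrite gtn_eqF // (leq_ltn_trans _ jn).
apply: (@run_within_seq _ _ _ _ _ _ (st 0 0)).
  apply: run_within_act => //; congr pair; apply/funext => i; apply/funext => j.
  rewrite leqn0 /=; case: eqP => [->|//].
  by rewrite ffunE /= origW.
apply: (@run_within_seq _ _ _ _ _ _ (st n n)).
  apply: (@run_within_while _ _ _ _ 2 n (fun t => st t t)) => //.
    move=> t tn; rewrite /at_end ffunE /= leqnn letterN -ltnNge; split=> //.
    apply: (@run_within_seq _ _ _ _ _ 1 (st t.+1 t) 1).
      apply: run_within_act => //; congr pair.
      apply/funext => i; apply/funext => j /=.
      by case: (j =P t) => [->|//]; rewrite ffunE.
    apply: run_within_act => //; congr pair.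
    apply/funext => i; apply/funext => j /=.
    case: (ltngtP j t.+1) => [jt|jt|->].
    - by rewrite -ltnS jt.
    - by rewrite leqNgt (ltn_trans _ jt).
    - by rewrite ffunE /= ltnn origW.
  by rewrite negbK /at_end ffunE /= leqnn letterN.
apply: (@run_within_while _ _ _ _ 1 n (fun t => st (n - t) n)).
- by rewrite subn0.
- by rewrite subnn st_n.
- move=> t tn; rewrite !st_n marked_cfg -lt0n subn_gt0; split=> //.
  by apply: run_mv => i; rewrite ?subnS // subn_gt0.
- by rewrite negbK st_n marked_cfg subnn.
Qed.

(** ** The least model *)

Definition le_mem (m m' : memory) : Prop := forall p, m p \subset m' p.

Lemma le_mem_trans m1 m2 m3 : le_mem m1 m2 -> le_mem m2 m3 -> le_mem m1 m3.
Proof. by move=> m12 m23 p; apply: subset_trans (m23 p). Qed.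

Lemma le_mem_anti m1 m2 : le_mem m1 m2 -> le_mem m2 m1 -> m1 = m2.
Proof.
by move=> m12 m21; apply/funext => p; apply/eqP; rewrite eqEsubset m12 m21.
Qed.

Section Inflationary.
Variables (T : Type) (f : memory -> T -> memory).
Hypothesis le_f : forall m v, le_mem m (f m v).

Lemma le_foldl s m : le_mem m (foldl f m s).
Proof.
by elim: s m => [|v s IH] m //=; apply: le_mem_trans (IH _); apply: le_f.
Qed.

(** The memory only grows, so a pass that ends where it began cannot have changed anything in
    between. *)
Lemma foldl_fix s m : foldl f m s = m -> Forall (fun v => f m v = m) s.
Proof.
elim: s m => [//|v s IH] m /= E.
have fv : f m v = m.
  by apply: le_mem_anti (le_f _ _); rewrite -{2}E; apply: le_foldl.
by split=> //; apply: IH; rewrite fv in E.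
Qed.

End Inflationary.

Lemma foldl_const (T U : Type) (g : T -> T) z (s : seq U) :
  foldl (fun z _ => g z) z s = iter (size s) g z.
Proof. by elim: s z => //= u s IH z; rewrite IH -iterSr. Qed.

(** If round [B] still changed something, so did every earlier round, and the measure would have
    risen [B.+1] times, beyond its bound [B]. *)
Lemma iter_measure_fix (T : Type) (g : T -> T) (P : T -> Prop) (mu : T -> nat)
    B z :
  (forall z, P z -> P (g z)) ->
  (forall z, P z -> g z <> z -> mu z < mu (g z)) ->
  (forall z, P z -> mu z <= B) -> P z -> g (iter B g z) = iter B g z.
Proof.
move=> Pg mug muB Pz; case: (pselect (g (iter B g z) = iter B g z)) => // nfix.
have Pi i : P (iter i g z) by elim: i => //= i /Pg.
have nfix_i i : i <= B -> g (iter i g z) <> iter i g z.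
  move=> iB gi; apply: nfix; rewrite -(subnK iB) iterD.
  by elim: (B - i) => //= d E; rewrite !E.
have mu_i i : i <= B.+1 -> i <= mu (iter i g z).
  elim: i => //= i IH iB; apply: leq_ltn_trans (IH (ltnW iB)) _.
  exact: mug (Pi i) (nfix_i i iB).
by have := leq_trans (mu_i B.+1 (leqnn _)) (muB _ (Pi B.+1)); rewrite ltnn.
Qed.

Section Loops.
Variables (F : seq I -> pos -> memory -> memory) (w : seq I).

Lemma le_loops l : (forall x m, le_mem m (F w x m)) ->
  forall x m, le_mem m (loops F l w x m).
Proof.
move=> leF; elim: l => //= i l IH x m.
by apply: le_foldl => m' v; apply: IH.
Qed.

Lemma loops_fix l x y m : (forall x m, le_mem m (F w x m)) ->
  loops F l w x m = m -> {in l, forall i, y i <= size w} ->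
  (forall i, i \notin l -> y i = x i) -> F w y m = m.
Proof.
move=> leF; elim: l x => [|i l IH] x /= fix_x yn yx.
  by have -> : y = x by apply/funext => i; apply: yx.
have le_i m' v : le_mem m' (loops F l w (upd x i v) m') by apply: le_loops.
have /Forall_in/(_ (y i)) := foldl_fix le_i fix_x.
rewrite mem_iota ltnS yn ?mem_head // => /(_ isT)/IH; apply.
  by move=> j jl; apply: yn; rewrite inE jl orbT.
move=> j jl; rewrite /upd; case: eqP => [->//|/eqP ji].
by apply: yx; rewrite inE negb_or ji.
Qed.

Lemma loops_ind l (P : memory -> Prop) x m :
  (forall y m, (forall i, y i <= size w) -> P m -> P (F w y m)) ->
  (forall i, x i <= size w) -> P m -> P (loops F l w x m).
Proof.
move=> PF; elim: l x m => [|i l IH] x m xn Pm /=; first exact: PF.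
rewrite /loop; set s := iota _ _.
have : all (fun v => v <= size w) s.
  by apply/allP => v; rewrite mem_iota ltnS.
elim: s m Pm => //= v s IHs m Pm /andP[vn sn]; apply: IHs => //.
by apply: IH => // j; rewrite /upd; case: ifP.
Qed.

(** The counters of rounds are not variables, so a pass does not depend on them; this turns the
    outer loops into plain iteration. *)
Lemma eq_loops l :
  (forall x y m, (forall v, v < K -> x (var v) = y (var v)) ->
     F w x m = F w y m) ->
  forall x y m, (forall v, v < K -> x (var v) = y (var v)) ->
     loops F l w x m = loops F l w y m.
Proof.
move=> eqF; elim: l => //= i l IH x y m xy.
congr (foldl _ m _); apply/funext => m'; apply/funext => v.
by apply: IH => u uK; rewrite /upd xy.
Qed.

End Loops.

Lemma le_fire w x m r : le_mem m (fire w x m r).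
Proof.
case: r => l q a b /= p; case: ifP => // _; rewrite /add_bit.
by case: ifP => // _; apply: subsetUr.
Qed.

Lemma eq_fire_all rs w x y m :
  all (fun v => v < K) (flatten (map rule_vars rs)) ->
  (forall v, v < K -> x (var v) = y (var v)) ->
  fire_all rs w x m = fire_all rs w y m.
Proof.
move=> + xy; elim: rs m => //= r rs IH m; rewrite all_cat => /andP[rK rsK].
rewrite /fire_all /= (@eq_fire _ _ (fun v => y (var v))) -?/(fire_all _ _ _ _).
  exact: IH.
by move=> v vr; apply: xy; apply: (allP rK).
Qed.

Lemma fire_all_fix rs w x alpha m :
  all (fun v => v < K) (flatten (map rule_vars rs)) ->
  (forall v, v < K -> x (var v) = alpha v) ->
  fire_all rs w x m = m -> Forall (fun r => fire w alpha m r = m) rs.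
Proof.
move=> rsK xa /(foldl_fix (@le_fire _ _)).
elim: rs rsK => //= r rs IH; rewrite all_cat => /andP[rK /IH{}IH] [rm /IH].
split=> //; rewrite -[RHS]rm; apply: eq_fire => v vr.
by rewrite xa //; apply: (allP rK).
Qed.

(** * Counting marks, soundness of firing, and closedness of a fixpoint *)

Definition small_mem (w : seq I) (m : memory) : Prop :=
  forall p, (size w).+1 * (size w).+1 <= p -> m p = set0.

Lemma small_fire w x m r : (forall v, x v <= size w) ->
  small_mem w m -> small_mem w (fire w x m r).
Proof.
case: r => l q a b xn sm p pn /=; case: ifP => // _; last exact: sm.
rewrite /add_bit; case: eqP => [E|_]; last exact: sm.
by have := xn a; have := xn b; nia.
Qed.

Definition bits (w : seq I) (m : memory) : nat :=
  \sum_(p < (size w).+1 * (size w).+1) #|m p|.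

Lemma bits_leq w m : bits w m <= (size w).+1 * ((size w).+1 * #|Q|).
Proof.
rewrite mulnA -[X in X * _]card_ord -sum_nat_const.
by apply: leq_sum => p _; apply: max_card.
Qed.

Lemma bits_lt w m m' : small_mem w m -> small_mem w m' -> le_mem m m' ->
  m' <> m -> bits w m < bits w m'.
Proof.
move=> sm sm' mm' neq; rewrite /bits ltnNge; apply/negP => le_bits.
apply: neq; apply/funext => p; apply/esym/eqP; rewrite eqEcard mm' /=.
case: (leqP ((size w).+1 * (size w).+1) p) => pn.
  by rewrite sm' // cards0.
rewrite leqNgt; apply/negP => ltp.
suff : bits w m < bits w m' by rewrite ltnNge le_bits.
rewrite /bits (bigD1 (Ordinal pn)) //= [ltnRHS](bigD1 (Ordinal pn)) //=.
rewrite -addSn leq_add //; apply: leq_sum => i _.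
exact: subset_leq_card.
Qed.

(** The invariant is claimed only for [j <= size w], where division by [(size w).+1] recovers the
    pair from its cell. *)
Lemma fire_sound w (R : Q -> nat -> nat -> Prop) x m r :
  (forall v, x v <= size w) -> closed_rule w R r ->
  (forall q i j, j <= size w -> mem_rel w m q i j -> R q i j) ->
  forall q i j, j <= size w -> mem_rel w (fire w x m r) q i j -> R q i j.
Proof.
case: r => l q a b /= xn clR mR q' i j jn.
case: ifP => [lx|_]; last exact: mR.
rewrite /mem_rel /add_bit; case: eqP => [E|_]; last exact: mR.
have ia : i = x a.
  have := congr1 (fun p => p %/ (size w).+1) E.
  by rewrite !divnMDl // !divn_small ?ltnS // !addn0.
have -> : j = x b by move: E; rewrite ia => /addnI.
rewrite ia.
rewrite inE => /orP[/set1P ->|qm]; last exact: mR.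
apply: clR => //; elim: l lx => //= c l IH /andP[cx lx]; split; last exact: IH.
case: c cx => [s p u v|u f|u] /= => [|/eqP|/eqP] //.
exact: mR.
Qed.

Lemma fire_fix_closed w m l q a b :
  (forall x : nat -> nat, (forall v, x v <= size w) ->
     fire w x m (Rule l q a b) = m) ->
  closed_rule w (mem_rel w m) (Rule l q a b).
Proof.
move=> fix_m x xn lx.
suff lb : all (atomb w m x) l.
  have := fix_m x xn; rewrite /= lb /mem_rel => <-.
  by rewrite /add_bit eqxx inE set11.
by elim: l lx {fix_m} => //= c l IH [cx /IH ->]; rewrite andbT; apply/atombP.
Qed.

End Machine.

Lemma Forall_swap (T U : Type) (P : T -> U -> Prop) s :
  (forall x, Forall (P x) s) -> Forall (fun y => forall x, P x y) s.
Proof.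
elim: s => //= y s IH H; split=> [x|]; first by case: (H x).
by apply: IH => x; case: (H x).
Qed.

Lemma leq_sumn v s : v \in s -> v <= sumn s.
Proof.
elim: s => //= u s IH /[!inE] /predU1P[->|/IH]; first exact: leq_addr.
by move=> vs; apply: leq_trans vs (leq_addl _ _).
Qed.

Theorem datalog_ptime (rules : seq rule) (q0 : Q) :
  exists (M : TM I) (p : {poly nat}), forall w, exists b : bool,
    tm_answers_within M w p.[size w]%R b /\
    (b <-> forall R, Forall (closed_rule w R) rules -> R q0 0 0).
Proof.
pose K := (sumn (flatten (map rule_vars rules))).+1.
have rulesK : all (fun v => v < K) (flatten (map rule_vars rules)).
  by apply/allP => v /leq_sumn; rewrite ltnS.
(* Two loops of [n.+1] rounds around [#|Q|] unrolled passes give as many passes as there can be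
   marks. *)
pose counters : seq 'I_(K + 4).+1 := [:: tp K 3; tp K 4].
pose vars := [seq var K v | v <- iota 0 K].
have vars_inj : {in iota 0 K &, injective (var K)}.
  move=> u v; rewrite !mem_iota /= => uK vK /eqP.
  by rewrite tp_eq ?eqn_add2l => [/eqP||]; lia.
have uniq_vars : uniq vars by rewrite (map_inj_in_uniq vars_inj) iota_uniq.
have tp_vars i : i < 5 -> tp K i \notin vars.
  move=> i5; apply/mapP => -[v]; rewrite mem_iota => /= vK /eqP.
  by rewrite tp_eq; lia.
have [T pT HT] : exists2 T, poly_bounded T & forall w x m, valid w x ->
    {in counters ++ vars, forall i, x i = 0} -> run_within
      (for_all_cmd counters (repeat_cmd #|Q| (for_all_cmd vars
        (rules_cmd K rules)))) (cfg w x m) (T (size w))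
      (cfg w x (loops
         (fun w x m => iter #|Q| (loops (fire_all rules) vars w x) m)
         counters w x m)).
  apply: implements_for_all.
  - by rewrite /= !inE !tp_eq //; lia.
  - rewrite 2!cat_cons cat0s 2!cons_uniq in_cons negb_or !tp_vars //
      uniq_vars tp_eq //;
      lia.
  apply: implements_repeat.
  have := @implements_for_all _ vars [::] _ (fire_all rules); rewrite cats0.
  apply.
  - apply/allP => i /mapP[v]; rewrite mem_iota => /= vK ->.
    by rewrite !inE !tp_eq //; lia.
  - by [].
  exact: implements_rules.
have [p Hp] : poly_bounded
    (fun n => (1 + ((n * 3).+1 + (n * 2).+1) + T n).+1).
  apply/poly_bounded_S/poly_bounded_add => //.
  have lin c : poly_bounded (fun n => (n * c).+1).
    exact/poly_bounded_S/poly_bounded_mul/poly_bounded_const/poly_bounded_id.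
  exact: poly_bounded_add (poly_bounded_const 1)
    (poly_bounded_add (lin 3) (lin 2)).
exists (cmd_TM (blank_cell) input_cell
  (Seq (init_cmd K) (for_all_cmd counters (repeat_cmd #|Q| (for_all_cmd vars
        (rules_cmd K rules))))) (@has_bit K q0)), p => w.
set n := size w; pose x0 (i : 'I_(K + 4).+1) := 0.
pose G := loops (fire_all rules) vars w x0.
pose m0 : memory := fun _ => set0.
pose N := n.+1 * (n.+1 * #|Q|).
have loops_iter :
    loops (fun w x m => iter #|Q| (loops (fire_all rules) vars w x) m)
    counters w x0 m0 = iter N G m0.
  pose H w x m := iter #|Q| (loops (fire_all rules) vars w x) m.
  rewrite -[LHS]/(loop (loop H (tp K 4)) (tp K 3) w x0 m0).
  rewrite /loop /N iterM -[X in iter X _ _](size_iota 0) -foldl_const.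
  congr (foldl _ _ _); apply/funext => m; apply/funext => v.
  rewrite iterM -[X in iter X _ _](size_iota 0) -foldl_const.
  congr (foldl _ _ _); apply/funext => m'; apply/funext => v'.
  congr (iter _ _ m'); apply/funext => m''.
  apply: eq_loops => [x y m1|u uK]; first exact: eq_fire_all.
  by rewrite /upd !tp_eq //; lia.
exists (mem_rel w (iter N G m0) q0 0 0); split.
  have -> : mem_rel w (iter N G m0) q0 0 0 =
      has_bit q0 (scan (cfg w x0 (iter N G m0))).
    by rewrite /has_bit ffunE /= eqxx.
  have [t tT rt] : tm_answers_within (cmd_TM (blank_cell) input_cell
      (Seq (init_cmd K) (for_all_cmd counters (repeat_cmd #|Q| (for_all_cmd vars
      (rules_cmd K rules))))) (@has_bit K q0)) w
      (1 + ((n * 3).+1 + (n * 2).+1) + T n).+1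
      (has_bit q0 (scan (cfg w x0 (iter N G m0)))).
    apply/cmd_TM_answers/run_within_seq; first exact: run_init.
    have := HT w x0 m0; rewrite loops_iter; apply.
      by split=> // i; rewrite /x0.
    by [].
  by exists t => //; apply: leq_trans tT (Hp _).
have small_G m : small_mem w m -> small_mem w (G m).
  apply: loops_ind => // y m' yn; rewrite /fire_all.
  elim: (rules) m' => //= r rs IH m' sm; apply: IH; exact: small_fire.
have le_fire_all x m : le_mem m (fire_all rules w x m).
  by apply: le_foldl => m' r; apply: le_fire.
have fix_G : G (iter N G m0) = iter N G m0.
  apply: (@iter_measure_fix _ _ (small_mem w) (bits w)) => //.
  - move=> m sm; apply: bits_lt => //; first exact: small_G.
    exact: le_loops.
  - by move=> m _; apply: bits_leq.
split=> [b R clR|].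
  suff : forall q i j, j <= n -> mem_rel w (iter N G m0) q i j -> R q i j.
    by apply; rewrite ?b.
  elim: (N) => [|k mR] /=; first by move=> q i j _; rewrite /mem_rel inE.
  apply: (@loops_ind _ (fire_all rules) w _
    (fun m => forall q i j, j <= n -> mem_rel w m q i j -> R q i j)) => //.
  move=> y m' yn; rewrite /fire_all; elim: (rules) m' clR => //= r rs IH m'.
  move=> [clr clrs] m'R; apply: IH => //; exact: fire_sound.
(* The fixpoint is itself a model, so the atom that holds in every model is marked in it. *)
set m := iter N G m0 in fix_G *; move/(_ (mem_rel w m)); apply.
suff fix_r : Forall (fun r => forall x : nat -> nat, (forall v, x v <= n) ->
    fire w x m r = m) rules.
  by elim: (rules) fix_r => //= -[l q a b] rs IH [/fire_fix_closed rm /IH].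
apply: Forall_swap => x.
have [xn|/existsNP[v vn]] := pselect (forall v, x v <= n); last first.
  by elim: (rules) => //= r rs IH; split=> // /(_ v).
(* Subtracting 5 inverts the numbering of [var]; the other heads rest at 0, as in [x0]. *)
pose y (i : 'I_(K + 4).+1) := if i \in vars then x (i - 5) else 0.
have yx v : v < K -> y (var K v) = x v.
  move=> vK; rewrite /y map_f ?mem_iota //.
  by rewrite /var /tp /= inordK ?addKn //; lia.
have : fire_all rules w y m = m.
  apply: (@loops_fix K (fire_all rules) w vars x0 y m) => //.
    by move=> i _; rewrite /y; case: ifP.
  by move=> i; rewrite /y => /negbTE ->.
move/(fire_all_fix rulesK yx).
by elim: (rules) => //= r rs IH [-> /IH].
Qed.

End Datalog.
From Stdlib Require Import Relation_Operators.
From mathcomp Require Import classical_sets cardinality.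

(** * Infinite walks *)

(** Choice turns the hypothesis into a successor function, whose orbit stays in the finite list [L]
    and therefore repeats a vertex. *)
Lemma walk_to_cycle (X : eqType) (e : rel X) (L : seq X) (P : X -> Prop) x :
  (forall y, P y -> exists z, [/\ e y z, P z & z \in L]) -> P x ->
  exists p c, [/\ path e x p, ucycle e c & last x p \in c].
Proof.
move=> Pe Px.
have /choice[g Pg] : forall y, exists z, P y -> [/\ e y z, P z & z \in L].
  move=> y; have [/Pe[z ez]|nPy] := pselect (P y); first by exists z.
  by exists y => /nPy.
have Piter y k : P y -> P (iter k g y).
  by elim: k => //= k IH /IH /Pg[].
have path_g y k : P y -> path e y (traject g (g y) k).
  by elim: k y => //= k IH y /Pg[-> Pgy _]; apply: IH.
(* The start [x] may lie outside [L], so the pigeonhole argument begins at [g x]. *)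
have : ~~ uniq (traject g (g x) (size L).+1).
  apply/negP => /uniq_leq_size -/(_ L); rewrite size_traject ltnn.
  suff sub : {subset traject g (g x) (size L).+1 <= L} by move/(_ sub).
  move=> _ /trajectP[i _ ->]; rewrite -iterSr /=.
  by case: (Pg _ (Piter x i Px)).
rewrite looping_uniq negbK => /trajectP[i iL loop_i].
set z := iter i g (g x) in loop_i.
have Pz : P z by rewrite /z -iterSr; apply: Piter.
have [d dE] : exists d, size L = d.+1 + i by exists (size L - i).-1; lia.
have last_z : last (g z) (traject g (g (g z)) d) = z.
  by rewrite last_traject -iterSr /z -iterD -dE.
have := path_g z d.+1 Pz; rewrite /= => /andP[ez path_z].
(* The closed walk through [z] may repeat vertices, whereas [ucycle] asks for a simple cycle. *)
move: last_z; case/shortenP: path_z => p' path_p' uniq_p' _ last_z.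
exists (traject g (g x) i.+1), (g z :: p'); split.
- exact: path_g.
- by rewrite /ucycle uniq_p' /= rcons_path path_p' last_z ez.
- rewrite trajectSr last_rcons -/z.
  by have := mem_last (g z) p'; rewrite last_z.
Qed.

(** * Infinite congruence classes *)

Section Congruence.
Variables (S : signature) (Gamma : seq (equation S)).

Definition children (t : term S) : seq (term S) :=
  let: App f ts := t in [seq ts i | i <- enum 'I_(arity f)].

Lemma App_inj (f : symbol S) (ts us : {ffun 'I_(arity f) -> term S}) :
  App ts = App us -> ts = us.
Proof.
move=> [] /eqP E; apply/eqP.
by move: E; rewrite eq_Tagged.
Qed.

Lemma App_const (c : symbol S) (hc : arity c = 0)
    (ts : {ffun 'I_(arity c) -> term S}) : App ts = const_term hc.
Proof.
by congr App; apply/ffunP => i; have := ltn_ord i; rewrite [X in _ < X]hc.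
Qed.

Lemma term_size_children t :
  term_size t = (\sum_(u <- children t) term_size u).+1.
Proof. by case: t => f ts /=; rewrite big_map big_enum. Qed.

Lemma term_size_leq t B : {in children t, forall u, term_size u <= B} ->
  term_size t <= (size (children t) * B).+1.
Proof.
rewrite term_size_children ltnS.
elim: (children t) => [|u s IH] uB; first by rewrite big_nil.
rewrite big_cons mulSn leq_add //; first by apply: uB; rewrite mem_head.
by apply: IH => v vs; apply: uB; rewrite inE vs orbT.
Qed.

(** Congruence that can be derived without rewriting at the root. *)
Definition alike (t u : term S) : Prop :=
  exists (f : symbol S) (ts us : {ffun 'I_(arity f) -> term S}),
    [/\ t = App ts, u = App us & forall i, cong Gamma (ts i) (us i)].

Lemma alike_refl t : alike t t.
Proof.
by case: t => f ts; exists f, ts, ts; split=> // i; apply: cong_refl.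
Qed.

Lemma alike_sym t u : alike t u -> alike u t.
Proof.
by move=> [f [ts [us [-> -> tu]]]]; exists f, us, ts; split=> // i;
  apply: cong_sym.
Qed.

Lemma alike_trans t u v : alike t u -> alike u v -> alike t v.
Proof.
move=> [f [ts [us [-> -> tu]]]] [g [us' [vs [E -> uv]]]].
have fg : f = g by case: E.
subst g; rewrite -(App_inj E) in uv.
by exists f, ts, vs; split=> // i; apply: cong_trans (tu i) (uv i).
Qed.

(** Unless a derivation avoids the root, it has a first and a last equation applied there; [p] and
    [q] are the outer sides of these. In the transitive case the middle parts merge into a
    congruence between sides. *)
Lemma cong_cases t u : cong Gamma t u -> alike t u \/
  exists p q, [/\ p \in eqs_sides Gamma, q \in eqs_sides Gamma, alike t p,
    alike q u & cong Gamma p q].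
Proof.
elim=> {t u} [p q pq|t|t u _|t u v _ IHtu _ IHuv|f ts us tu _].
- right; exists p, q; rewrite !mem_undup !mem_cat.
  split; [| |exact: alike_refl|exact: alike_refl|exact: cong_ax].
    by rewrite (map_f (@fst _ _) pq).
  by rewrite (map_f (@snd _ _) pq) orbT.
- by left; apply: alike_refl.
- move=> [/alike_sym|[p [q [ps qs tp qu pq]]]]; first by left.
  by right; exists q, p; split=> //; [apply: alike_sym..|apply: cong_sym].
- case: IHtu IHuv => [tu|[p [q [ps qs tp qu pq]]]]
    [uv|[p' [q' [ps' qs' up' qv' pq']]]].
  + by left; apply: alike_trans uv.
  + by right; exists p', q'; split=> //; apply: alike_trans up'.
  + by right; exists p, q; split=> //; apply: alike_trans uv.
  + right; exists p, q'; split=> //; apply: cong_trans pq _.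
    apply: cong_trans pq'; have [f [ss [ss' [-> -> E]]]] := alike_trans qu up'.
    exact: cong_app.
- by left; exists f, ts, us.
Qed.

Lemma alike_children t u v : alike t u -> v \in children u ->
  exists2 v', v' \in children t & cong Gamma v' v.
Proof.
move=> [f [ts [us [-> -> tu]]]] /= /mapP[i _ ->].
by exists (ts i) => //; apply: map_f; rewrite mem_enum.
Qed.

(** * Unbounded term sizes within a class *)

Definition reaches_size (n : nat) (t : term S) : Prop :=
  exists2 u, cong Gamma t u & n <= term_size u.

Definition unbounded (t : term S) : Prop := forall n, reaches_size n t.

Lemma reaches_size_leq n m t : n <= m -> reaches_size m t -> reaches_size n t.
Proof. by move=> nm [u tu mu]; exists u => //; apply: leq_trans mu. Qed.

Lemma reaches_size_cong n t u :
  cong Gamma t u -> reaches_size n u -> reaches_size n t.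
Proof. by move=> tu [v uv nv]; exists v => //; apply: cong_trans uv. Qed.

Lemma reaches_size_child n t u :
  u \in children t -> reaches_size n u -> reaches_size n.+1 t.
Proof.
case: t => f ts /= /mapP[i _ ->] [v iv nv].
exists (App [ffun j => if j == i then v else ts j]).
  by apply: cong_app => j; rewrite ffunE; case: eqP => [->|_] //;
    apply: cong_refl.
rewrite /= ltnS (bigD1 i) //= ffunE eqxx; exact: leq_trans (leq_addr _ _).
Qed.

Lemma common_bound (s : seq (term S)) : {in s, forall t, ~ unbounded t} ->
  exists B, {in s, forall t u, cong Gamma t u -> term_size u <= B}.
Proof.
elim: s => [|t s IH] bs; first by exists 0.
have [|B HB] := IH; first by move=> u us; apply: bs; rewrite inE us orbT.
have /existsNP[n nt] := bs t (mem_head _ _).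
exists (maxn n B) => u /[!inE] /predU1P[->|us] v uv.
  rewrite leq_max; apply/orP; left; rewrite leqNgt; apply/negP => nv.
  by apply: nt; exists v => //; apply: ltnW.
by rewrite leq_max (HB u us v uv) orbT.
Qed.

(** Suppose that all children of [t] and of the sides congruent to [t] have bounded classes, with
    common bound [B]. Every term congruent to [t] is alike to one of these terms, so its children
    have size at most [B], and its own size is bounded as well. *)
Lemma unbounded_step t : unbounded t -> exists q u,
  [/\ u \in children q, unbounded u &
      q = t \/ q \in eqs_sides Gamma /\ cong Gamma t q].
Proof.
move=> ut; apply: contrapT => nstep.
pose s := t :: [seq q <- eqs_sides Gamma | `[< cong Gamma t q >]].
have [|B HB] := @common_bound (flatten (map children s)).
  move=> u /flattenP[_ /mapP[q qs ->] uq] uu; apply: nstep; exists q, u.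
  split=> //; move: qs; rewrite inE mem_filter.
  by case/predU1P => [|/andP[/asboolP]]; [left | right].
pose m := \max_(f : symbol S) arity f.
(* One more than the largest size of a term with at most [m] children of size at most [B]. *)
have [u tu] := ut (m * B).+2; rewrite ltnNge => /negP; apply.
suff [q qs qu] : exists2 q, q \in s & alike q u.
  apply: leq_trans (term_size_leq (B := B) _) _.
    move=> v /(alike_children qu)[v' v'q]; apply: HB.
    by apply/flattenP; exists (children q) => //; apply: map_f.
  rewrite ltnS leq_mul2r; apply/orP; right; case: (u) => f us /=.
  by rewrite size_map size_enum_ord; apply: leq_bigmax.
case: (cong_cases tu) => [|[p [q [ps qs tp qu pq]]]].
  by exists t => //; rewrite mem_head.
exists q => //; rewrite inE mem_filter qs andbT; apply/orP; right.
apply/asboolP; apply: cong_trans pq.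
by have [f [ss [ss' [-> -> E]]]] := tp; apply: cong_app.
Qed.

Lemma finite_small_terms n :
  exists s : seq (term S), forall t, term_size t <= n -> t \in s.
Proof.
elim: n => [|n [s Hs]]; first by exists [::]; case.
exists (flatten [seq [seq App [ffun i => tnth (in_tuple s) (g i)] |
  g : {ffun 'I_(arity f) -> 'I_(size s)} <-
    enum {: {ffun 'I_(arity f) -> 'I_(size s)}}]
  | f : symbol S <- enum (symbol S)]).
case=> f ts; rewrite term_size_children ltnS => szt.
apply/flattenP; eexists; first by apply: map_f (mem_enum _ f).
have tss i : ts i \in s.
  apply: Hs; apply: leq_trans szt.
  by rewrite /= big_map big_enum /= (bigD1 i) //= leq_addr.
have idx i : index (ts i) s < size s by rewrite index_mem.
apply/mapP; exists [ffun i => Ordinal (idx i)]; first by rewrite mem_enum.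
congr App; apply/ffunP => i.
by rewrite !ffunE (tnth_nth (ts i)) /= nth_index.
Qed.

Lemma infinite_class t : infinite_set (cong_class Gamma t) <-> unbounded t.
Proof.
split=> [inf n|ut /finite_seqP[s Es]].
  apply: contrapT => nt; apply: inf.
  have [s Hs] := finite_small_terms n.
  apply: (@sub_finite_set _ _ [set` s]%classic); last exact: finite_seq.
  move=> u tu /=; apply: Hs; rewrite leqNgt; apply/negP => nu.
  by apply: nt; exists u => //; apply: ltnW.
have [u tu] := ut (\max_(v <- s) term_size v).+1.
have us : u \in s by have : cong_class Gamma t u by []; rewrite Es.
by rewrite ltnNge (@leq_bigmax_seq _ _ predT).
Qed.

(** A term that is not a constant inherits unboundedness from its first child, so the constants
    decide. *)
Lemma all_classes_infinite_consts : all_classes_infinite Gamma <->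
  forall (c : symbol S) (hc : arity c = 0), unbounded (const_term hc).
Proof.
split=> [inf c hc|uc t]; first exact/infinite_class.
apply/infinite_class; elim/term_induction: t => f ts IH n.
case: (posnP (arity f)) => [f0|fgt]; first by rewrite (App_const f0); apply: uc.
apply: (@reaches_size_leq _ n.+1) => //.
apply: reaches_size_child (IH (Ordinal fgt) n).
by apply: map_f; rewrite mem_enum.
Qed.

(** * Cyclic types *)

Definition node_term (v : node Gamma) : option (term S) :=
  subterm_at (val v).1 (val v).2.

Lemma node_termP v : exists s, node_term v = Some s.
Proof.
rewrite /node_term; have /andP[_] := valP v.
by case: subterm_at => // s _; exists s.
Qed.

Lemma has_type_cong s s' C :
  has_type Gamma s C -> has_type Gamma s' C -> cong Gamma s s'.
Proof.
move=> [[p _ ->] [q [_ pq] sq]] [_ [q' [_ pq'] sq']].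
apply: cong_trans sq _; apply: cong_trans (cong_sym sq').
exact: cong_trans (cong_sym pq) pq'.
Qed.

Lemma quot_vertex_refl (v : node Gamma) : quot_vertex v v.
Proof. exact: rst_refl. Qed.

Lemma quot_vertex_cong (v w : node Gamma) s s' : quot_vertex v w ->
  node_term v = Some s -> node_term w = Some s' -> cong Gamma s s'.
Proof.
move=> vw.
have {}vw : clos_refl_sym_trans _ (@type_edge S Gamma) v w by [].
elim: vw s s' => {v w} [v w vw|v|v w _ IH|v u w _ IH1 _ IH2] s s'.
- move: vw => [_ [C [[t Et tC] [t' Et' tC']]]]; rewrite /node_term Et Et'.
  by move=> [<-] [<-]; apply: has_type_cong tC tC'.
- by move=> -> [->]; apply: cong_refl.
- by move=> vs ws; apply/cong_sym/IH.
- move=> vs ws; have [t ut] := node_termP u.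
  exact: cong_trans (IH1 _ _ vs ut) (IH2 _ _ ut ws).
Qed.

Lemma subterm_at0 (t : term S) : subterm_at t [::] = Some t.
Proof. by case: t. Qed.

Lemma subterm_at_rcons (t s : term S) pi i : subterm_at t pi = Some s ->
  subterm_at t (rcons pi i) = subterm_at s [:: i].
Proof.
elim: pi t => [|j pi IH] t; first by rewrite subterm_at0 => -[->].
by case: t => f ts /=; case: insub => // k; apply: IH.
Qed.

Lemma subterm_at1 (s u : term S) :
  u \in children s <-> exists i, subterm_at s [:: i] = Some u.
Proof.
case: s => f ts; split=> [/mapP[i _ ->]|[i] /=].
  by exists i => /=; rewrite valK subterm_at0.
case: insubP => // j _ _; rewrite subterm_at0 => -[<-].
by apply: map_f; rewrite mem_enum.
Qed.

Definition vertex_reaches (n : nat) (X : set (node Gamma)) : Prop :=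
  forall v s, X v -> node_term v = Some s -> reaches_size n s.

(** The nodes of one vertex carry congruent terms, so the growth by one at the node where the edge
    starts is shared by all of them. *)
Lemma vertex_reaches_edge n X Y :
  quot_edge X Y -> vertex_reaches n Y -> vertex_reaches n.+1 X.
Proof.
move=> /asboolP[v [w [-> -> [v' [w' [vv' ww' [Et [i Epi]]]]]]]] Yn u s vu us.
have [s' vs'] := node_termP v'; have [r wr] := node_termP w'.
apply: (@reaches_size_cong _ s s').
  apply: quot_vertex_cong us vs'; exact: rst_trans (rst_sym _ _ _ _ vu) vv'.
apply: (@reaches_size_child _ _ r); last exact: Yn ww' wr.
by apply/subterm_at1; exists i; rewrite -(subterm_at_rcons _ vs') -Epi -Et.
Qed.

Lemma vertex_reaches_cycle n c X :
  ucycle (@quot_edge S Gamma) c -> X \in c -> vertex_reaches n X.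
Proof.
move=> /andP[cyc _]; elim: n X => [|n IH] X Xc.
  by move=> v s _ _; exists s => //; apply: cong_refl.
apply: vertex_reaches_edge (next_cycle cyc Xc) (IH _ _).
by rewrite mem_next.
Qed.

Lemma cyclic_unbounded t : of_cyclic_type Gamma t -> unbounded t.
Proof.
move=> [C tC [v [s vs sC] [p [c [path_p cyc_c last_c]]]]] n.
apply: (reaches_size_cong (has_type_cong tC sC)).
suff : vertex_reaches n (quot_vertex v).
  by move/(_ v s); apply=> //; apply: quot_vertex_refl.
elim: p (quot_vertex v) path_p last_c => [|Y p IH] X /=.
  by move=> _; apply: vertex_reaches_cycle.
move=> /andP[XY path_p] /(IH Y path_p) /(vertex_reaches_edge XY) H u r Xu ur.
by apply: reaches_size_leq (H u r Xu ur).
Qed.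

Fixpoint positions (t : term S) : seq (seq nat) :=
  let: App f ts := t in
  [::] :: flatten [seq [seq val i :: pi | pi <- positions (ts i)]
                  | i <- enum 'I_(arity f)].

Lemma mem_positions t pi s : subterm_at t pi = Some s -> pi \in positions t.
Proof.
elim: pi t => [|i pi IH] [f ts] //=; case: insubP => // j _ <- /IH pij.
rewrite inE; apply/flattenP; eexists; first by apply: map_f (mem_enum _ j).
exact: map_f.
Qed.

Lemma finite_nodes : exists L : seq (node Gamma), forall v, v \in L.
Proof.
exists (pmap insub [seq (p, pi) | p <- eqs_sides Gamma, pi <- positions p]).
move=> v; rewrite mem_pmap_sub; have /andP[vs _] := valP v.
have [s Es] := node_termP v.
by apply/allpairsPdep; exists (val v).1, (val v).2; split;
  [| exact: mem_positions Es | case: (val v)].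
Qed.

Lemma node_at p pi s : p \in eqs_sides Gamma -> subterm_at p pi = Some s ->
  exists2 v : node Gamma, val v = (p, pi) & node_term v = Some s.
Proof.
move=> ps Es; have vP : ((p, pi).1 \in eqs_sides Gamma) &&
  subterm_at (p, pi).1 (p, pi).2 by rewrite ps Es.
by exists (exist (fun v : term S * seq nat =>
  (v.1 \in eqs_sides Gamma) && subterm_at v.1 v.2) (p, pi) vP).
Qed.

Lemma node_child (v : node Gamma) q u : node_term v = Some q ->
  u \in children q ->
  exists2 w : node Gamma, child_edge v w & node_term w = Some u.
Proof.
move=> vq /subterm_at1[i Eu].
have /andP[vs _] := valP v.
have Ei := subterm_at_rcons i vq; rewrite Eu in Ei.
have [w Ew wu] := node_at vs Ei.
by exists w => //; rewrite /child_edge Ew; split=> //; exists i.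
Qed.

Definition side_class (q : term S) : set (term S) :=
  [set p | p \in eqs_sides Gamma /\ cong Gamma q p]%classic.

Lemma has_side_class t q : q \in eqs_sides Gamma -> cong Gamma t q ->
  has_type Gamma t (side_class q).
Proof.
move=> qs tq; split; first by exists q.
by exists q => //; split=> //; apply: cong_refl.
Qed.

(** Replacing [s] by a congruent side stays inside the quotient vertex, because both then have the
    same type; only the descent to a child uses an edge. *)
Lemma unbounded_edge (v : node Gamma) s : node_term v = Some s -> unbounded s ->
  exists (w : node Gamma) u, [/\ node_term w = Some u, unbounded u &
    quot_edge (quot_vertex v) (quot_vertex w)].
Proof.
move=> vs /unbounded_step[q [u [uq uu [Eq|[qs sq]]]]].
  subst q; have [w vw wu] := node_child vs uq.
  exists w, u; split=> //; apply/asboolP; exists v, w; split=> //.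
  by exists v, w; split=> //; apply: quot_vertex_refl.
have [v' _ vq] := node_at qs (subterm_at0 q).
have [w vw wu] := node_child vq uq.
exists w, u; split=> //; apply/asboolP; exists v, w; split=> //.
exists v', w; split=> //; last exact: quot_vertex_refl.
(* Type edges join distinct nodes only. *)
have [->|nvv'] := pselect (v = v'); first exact: quot_vertex_refl.
apply: rst_step; split=> //; exists (side_class q); split.
  by exists s => //; apply: has_side_class.
by exists q => //; apply/has_side_class/cong_refl.
Qed.

(** A constant has no child to descend to, so the first step must pass to a congruent side; this
    gives the constant its type. *)
Lemma unbounded_const_cyclic (c : symbol S) (hc : arity c = 0) :
  unbounded (const_term hc) -> of_cyclic_type Gamma (const_term hc).
Proof.
move=> uc; have [q [u [uq uu [Eq|[qs cq]]]]] := unbounded_step uc.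
  by move: uq; rewrite Eq /= => /mapP[i]; have := ltn_ord i;
    rewrite [X in _ < X]hc.
exists (side_class q); first exact: has_side_class.
have [v _ vq] := node_at qs (subterm_at0 q).
exists v; first by exists q => //; apply/has_side_class/cong_refl.
have [L HL] := finite_nodes.
apply: (@walk_to_cycle _ _ [seq quot_vertex v | v <- L]
  (fun X => exists (v : node Gamma) s,
     [/\ X = quot_vertex v, node_term v = Some s & unbounded s])).
  move=> _ [v' [s [-> vs us]]].
  have [w' [r [wr ur vw]]] := unbounded_edge vs us.
  exists (quot_vertex w'); split=> //; last exact: map_f.
  by exists w', r.
exists v, q; split=> // n; apply: reaches_size_cong (uc n); exact: cong_sym.
Qed.

Theorem all_classes_infinite_cyclic : all_classes_infinite Gamma <->
  forall (c : symbol S) (hc : arity c = 0),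
    of_cyclic_type Gamma (const_term hc).
Proof.
rewrite all_classes_infinite_consts; split=> H c hc.
  exact: unbounded_const_cyclic.
exact: cyclic_unbounded.
Qed.

End Congruence.
(** * Congruence closure on a set of terms *)

Section Terms.
Variable S : signature.
Implicit Types t u : term S.

Definition root t : symbol S := let: App f _ := t in f.

Lemma nth_children t0 (f : symbol S) (ts : {ffun 'I_(arity f) -> term S})
  (i : 'I_(arity f)) : nth t0 (children (App ts)) i = ts i.
Proof. by rewrite /= (nth_map i) ?size_enum_ord // nth_ord_enum. Qed.

Lemma size_children t : size (children t) = arity (root t).
Proof. by case: t => f ts; rewrite /= size_map size_enum_ord. Qed.

Lemma term_root_children t u :
  root t = root u -> children t = children u -> t = u.
Proof.
case: t u => [f ts] [g us] /= E; subst g => Ech.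
congr App; apply/ffunP => i.
by rewrite -(nth_children (ts i) ts) /= Ech (nth_children (ts i) us).
Qed.

Lemma term_of_children (f : symbol S) us : size us = arity f ->
  exists2 t, root t = f & children t = us.
Proof.
case: us => [|u us] Es.
  exists (const_term (esym Es)) => //.
  by apply: size0nil; rewrite size_children.
exists (App [ffun i : 'I_(arity f) => nth u (u :: us) i]) => //=.
apply: (@eq_from_nth _ u); first by rewrite size_map size_enum_ord.
move=> i; rewrite size_map size_enum_ord => ilt.
by rewrite (nth_children u _ (Ordinal ilt)) ffunE.
Qed.

Lemma children_induction (P : term S -> Prop) :
  (forall t, {in children t, forall u, P u} -> P t) -> forall t, P t.
Proof.
move=> IH; elim/term_induction => f ts IHts; apply: IH.
by move=> _ /mapP[i _ ->].
Qed.

Lemma cong_children Gamma t u : root t = root u ->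
  (forall i, i < arity (root t) ->
     cong Gamma (nth t (children t) i) (nth u (children u) i)) ->
  cong Gamma t u.
Proof.
case: t u => [f ts] [g us] E; rewrite [root _]/= [root _]/= in E; subst g => tu.
apply: cong_app => i.
by have := tu i (ltn_ord i); rewrite !nth_children.
Qed.

Section Closure.
Variables (Gamma : seq (equation S)) (occ : term S -> Prop)
  (E : term S -> term S -> Prop).
Hypotheses (occ_child : forall t u, occ t -> u \in children t -> occ u)
  (E_ax : forall p q, (p, q) \in Gamma -> [/\ occ p, occ q & E p q])
  (E_refl : forall t, occ t -> E t t)
  (E_sym : forall t u, E t u -> E u t)
  (E_trans : forall t u v, E t u -> E u v -> E t v)
  (E_app : forall t u, occ t -> occ u -> root t = root u ->
     (forall i, i < arity (root t) ->
        E (nth t (children t) i) (nth u (children u) i)) -> E t u).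

(* The [E]-class of a term of [occ] congruent to [t], as far as congruence is
   detected through [E] at each subterm, and the empty set if there is none. *)
Fixpoint closure_class (t : term S) : term S -> Prop :=
  let: App f ts := t in
  fun v => exists ss : {ffun 'I_(arity f) -> term S}, [/\ occ (App ss),
    forall i u, E (ss i) u <-> closure_class (ts i) u & E (App ss) v].

Lemma closure_class_occ t : occ t -> forall v, E t v <-> closure_class t v.
Proof.
elim/term_induction: t => f ts IH ot v.
have IHt i := IH i (occ_child ot (map_f ts (mem_enum _ i))).
split=> [tv|[ss [os ssE sv]]].
  by exists ts; split=> // i u; apply: IHt.
apply: E_trans sv; apply: E_app => // i ilt.
rewrite (nth_children _ _ (Ordinal ilt)) (nth_children _ _ (Ordinal ilt)).
apply/IHt/ssE/E_refl/(occ_child os).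
by apply: map_f; rewrite mem_enum.
Qed.

(** Having the same closure class is a congruence on all terms that contains [Gamma]. Thus
    derivations through terms outside [occ] are covered, while on [occ] the closure class is the
    [E]-class. *)
Lemma cong_closure_class t u : cong Gamma t u ->
  forall v, closure_class t v <-> closure_class u v.
Proof.
elim=> {t u} [p q pq|t|t u _ IH|t u r _ IH1 _ IH2|f ts us _ IH] v //.
- have [op oq Epq] := E_ax pq.
  rewrite -!closure_class_occ //; split=> H; last exact: E_trans H.
  exact: E_trans (E_sym Epq) H.
- by rewrite IH.
- by rewrite IH1.
- split=> -[ss [os ssE sv]]; exists ss; split=> // i r.
    exact: iff_trans (ssE i r) (IH i r).
  exact: iff_trans (ssE i r) (iff_sym (IH i r)).
Qed.

Lemma cong_complete t u : occ t -> occ u -> cong Gamma t u -> E t u.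
Proof.
move=> ot ou /cong_closure_class/(_ u) tu.
by apply/closure_class_occ/tu/closure_class_occ/E_refl.
Qed.

End Closure.

(** * Polish notation *)

Definition words (us : seq (term S)) : seq (symbol S) :=
  flatten (map (@term_word S) us).

Lemma term_wordE t : term_word t = root t :: words (children t).
Proof. by case: t => f ts; rewrite /words /= -map_comp. Qed.

Lemma words_cat us vs : words (us ++ vs) = words us ++ words vs.
Proof. by rewrite /words map_cat flatten_cat. Qed.

(** Unique readability of a sequence, relative to that of its members, so that it applies to the
    children inside the induction on terms. *)
Lemma words_inj_in us :
  {in us, forall t, forall u a b, term_word t ++ a = term_word u ++ b ->
     t = u /\ a = b} ->
  forall vs a b, size us = size vs -> words us ++ a = words vs ++ b ->
  us = vs /\ a = b.
Proof.
elim: us => [|t us IH] tP [|v vs] a b //= [Es]; rewrite /words /= -!catA.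
move=> /(tP t (mem_head _ _))[-> /IH[]//]; last by move=> -> ->.
by move=> u us' ; apply: tP; rewrite inE us' orbT.
Qed.

(** The first letter fixes the root, hence the number of children still to be read. *)
Lemma term_word_inj t u a b :
  term_word t ++ a = term_word u ++ b -> t = u /\ a = b.
Proof.
elim/children_induction: t u a b => t IH u a b.
rewrite !term_wordE /= => -[Er /(words_inj_in IH)[|Ec ->]].
  by rewrite !size_children Er.
by split=> //; apply: term_root_children.
Qed.

Lemma words_inj us vs a b : size us = size vs ->
  words us ++ a = words vs ++ b -> us = vs /\ a = b.
Proof. by apply: words_inj_in => t _; apply: term_word_inj. Qed.

Lemma letter_drop (I : finType) (w : seq I) x f : letter w x = Some f ->
  x < size w /\ drop x w = f :: drop x.+1 w.
Proof.
move=> lx; have xw : x < size w by rewrite ltnNge -letterN lx.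
split=> //; rewrite (drop_nth f xw); congr cons.
by move: lx; rewrite /letter (nth_map f) // => -[].
Qed.

Lemma drop_letter (I : finType) (w : seq I) x f s : drop x w = f :: s ->
  [/\ x < size w, letter w x = Some f & drop x.+1 w = s].
Proof.
move=> E; have xw : x < size w.
  by rewrite ltnNge; apply/negP => /drop_oversize; rewrite E.
rewrite (drop_nth f xw) in E; case: E => Ef Es; split=> //.
by rewrite /letter (nth_map f) // Ef.
Qed.

(** * Occurrences of terms in the input word *)

Variable w : seq (symbol S).

Definition at_pos (x : nat) (t : term S) : Prop :=
  exists s, drop x w = term_word t ++ s.

Lemma at_pos_inj x t u : at_pos x t -> at_pos x u -> t = u.
Proof. by move=> [a Ea] [b]; rewrite Ea => /term_word_inj[]. Qed.

Lemma at_pos_root x t : at_pos x t ->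
  [/\ x < size w, letter w x = Some (root t) &
      exists s, drop x.+1 w = words (children t) ++ s].
Proof.
move=> [s]; rewrite term_wordE /= => /drop_letter[xw lx Es].
by split=> //; exists s.
Qed.

Lemma at_pos_root_eq x t f : at_pos x t -> letter w x = Some f -> root t = f.
Proof. by move=> /at_pos_root[_ -> _] []. Qed.

Definition terms_between (k x y : nat) : Prop :=
  exists us, [/\ size us = k, y <= size w & drop x w = words us ++ drop y w].

Lemma at_pos_terms x y : terms_between 1 x y ->
  exists2 t, at_pos x t & drop x w = term_word t ++ drop y w.
Proof.
move=> [[|t [|u us]] [//= _ _]]; rewrite /words /= cats0 => E.
by exists t => //; exists (drop y w).
Qed.

Definition child_pos (x : nat) t (i : nat) : nat :=
  x.+1 + size (words (take i (children t))).

(** By unique readability the [i] terms that follow the root symbol are the first [i] children. *)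
Lemma at_pos_child x y t i : at_pos x t -> i < arity (root t) ->
  terms_between i x.+1 y -> at_pos y (nth t (children t) i).
Proof.
move=> /at_pos_root[_ _ [s Es]] ilt [us [Ei _]].
have isz : i < size (children t) by rewrite size_children.
rewrite Es -{1}(cat_take_drop i (children t)) words_cat -catA => /words_inj[].
  by rewrite size_takel ?Ei // ltnW.
move=> _ Ed; exists (words (drop i.+1 (children t)) ++ s).
by rewrite -Ed (drop_nth t isz) /words /= -catA.
Qed.

Lemma child_pos_drop x t i : at_pos x t ->
  drop (child_pos x t i) w = words (drop i (children t)) ++
    drop (x.+1 + size (words (children t))) w.
Proof.
move=> /at_pos_root[_ _ [s Es]].
have drop_x k : drop (x.+1 + k) w = drop k (drop x.+1 w).
  by rewrite drop_drop addnC.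
rewrite /child_pos !drop_x Es.
rewrite [drop (size (words (children t))) _]drop_size_cat //.
have -> : words (children t) =
    words (take i (children t)) ++ words (drop i (children t)).
  by rewrite -words_cat cat_take_drop.
by rewrite -catA drop_size_cat.
Qed.

Lemma at_child_pos x t i : at_pos x t -> i < arity (root t) ->
  at_pos (child_pos x t i) (nth t (children t) i).
Proof.
move=> xt; rewrite -size_children => ilt; rewrite /at_pos child_pos_drop //.
by rewrite (drop_nth t ilt) /words /= -catA; eexists.
Qed.

Lemma child_pos_leq x t i : at_pos x t -> child_pos x t i <= size w.
Proof.
move=> /at_pos_root[xw _ [s Es]].
have := congr1 size Es; rewrite size_drop size_cat /child_pos.
rewrite -{1}(cat_take_drop i (children t)) words_cat size_cat; lia.
Qed.

Lemma at_pos_leq x t : at_pos x t -> x <= size w.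
Proof. by move=> /at_pos_root[/ltnW]. Qed.

Lemma at_pos_end x t : at_pos x t -> x + size (term_word t) <= size w.
Proof.
move=> xt; have xw := at_pos_leq xt; have [s /(congr1 size)] := xt.
rewrite size_drop size_cat; lia.
Qed.

End Terms.

(** * The Datalog program *)

Section Program.
Variable S : signature.

(** At least 2 for every signature, since [Terms 2] spans the two sides of an equation. *)
Definition max_terms : nat := (\max_(f : symbol S) arity f).+2.

Definition tag : finType := ('I_max_terms.+1 + 'I_4)%type.

Definition Terms (k : nat) : tag := inl (inord k).
Definition Start : tag := inr (inord 0).
Definition Eq : tag := inr (inord 1).
Definition Reach : tag := inr (inord 2).
Definition Goal : tag := inr (inord 3).

Local Notation rule := (rule (symbol S) tag).
Local Notation atom := (atom (symbol S) tag).
Local Notation rel := (@Rel (symbol S) tag).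
Local Notation sym := (@Sym (symbol S) tag).
Local Notation zero := (@Zero (symbol S) tag).

Definition app_rule (f : symbol S) : rule :=
  Rule [:: sym 0 f; rel true (Terms (arity f)) 0 1] (Terms 1) 0 1.

Definition cons_rule (k : 'I_max_terms) : rule :=
  Rule [:: rel false (Terms 1) 0 1; rel false (Terms k) 1 2] (Terms k.+1) 0 2.

(* Variables 0 and 1 are the two terms; [i.*2.+4] and [i.*2.+1.+4] are their
   i-th children. *)
Definition cong_rule (f : symbol S) : rule :=
  Rule ([:: sym 0 f; sym 1 f;
            rel false (Terms 1) 0 2; rel false (Terms 1) 1 3] ++
    flatten [seq [:: rel true (Terms i) 0 i.*2.+4;
                     rel true (Terms i) 1 i.*2.+1.+4;
                     rel false Eq i.*2.+4 i.*2.+1.+4]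
            | i : 'I_(arity f) <- enum 'I_(arity f)]) Eq 0 1.

Definition reach_rule (f : symbol S) (i : 'I_(arity f)) : rule :=
  Rule [:: rel false Eq 0 1; sym 1 f; rel true (Terms i) 1 2] Reach 0 2.

(** For a fixed signature the quantifier over constants is a finite conjunction. The constant with
    index i owns the variables 2i+1, for an occurrence, and 2i+2, for a position that reaches
    itself; variable 0 is kept for the head. *)
Definition goal_rule : rule :=
  Rule (zero 0 :: flatten [seq if arity c == 0 then
      let k := (index c (enum (symbol S))).*2 in
      [:: sym k.+1 c; rel false Reach k.+1 k.+2; rel false Reach k.+2 k.+2]
      else [::] | c <- enum (symbol S)]) Goal 0 0.

(* Over positions x, y: [Terms k] holds if the word between x and y is a
   sequence of k terms, [Start] if an equation starts at x (= y), [Eq] if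
   congruent terms start at x and y, [Reach] if the term at y is reached from
   the one at x by at least one step to a child of a congruent term. *)
Definition program : seq rule :=
  [:: Rule [::] (Terms 0) 0 0;
      Rule [:: zero 0] Start 0 0;
      Rule [:: rel false Start 0 0; rel false (Terms 2) 0 1] Start 1 1;
      Rule [:: rel false Start 0 0; rel false (Terms 1) 0 1] Eq 0 1;
      Rule [:: rel false Eq 1 0] Eq 0 1;
      Rule [:: rel false Eq 0 1; rel false Eq 1 2] Eq 0 2;
      Rule [:: rel false Reach 0 1; rel false Reach 1 2] Reach 0 2;
      goal_rule] ++
  [seq app_rule f | f <- enum (symbol S)] ++
  [seq cong_rule f | f <- enum (symbol S)] ++
  [seq cons_rule k | k <- enum 'I_max_terms] ++
  flatten [seq [seq reach_rule i | i <- enum 'I_(arity f)]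
          | f <- enum (symbol S)].

Lemma Forall_enum_map (T : finType) (U : Type) (P : U -> Prop) (g : T -> U) :
  Forall P [seq g x | x <- enum T] <-> forall x, P (g x).
Proof. by rewrite Forall_map Forall_enum. Qed.

Lemma Forall_enum_flatten (T : finType) (U : Type) (P : U -> Prop)
    (g : T -> seq U) :
  Forall P (flatten [seq g x | x <- enum T]) <-> forall x, Forall P (g x).
Proof. by rewrite Forall_flatten Forall_map Forall_enum. Qed.

Lemma arity_lt (f : symbol S) : arity f < max_terms.
Proof. by rewrite ltnW // !ltnS leq_bigmax. Qed.

Section Word.
Variable Gamma : seq (equation S).
Let w := eqs_word Gamma.

(** ** Soundness *)

(* This reading of [Reach] makes a cycle give terms of every size. *)
Definition meaning (q : tag) (x y : nat) : Prop :=
  match q with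
  | inl k => terms_between w k x y
  | inr j => match val j with
      | 0 => exists2 G, {subset G <= Gamma} & drop x w = eqs_word G
      | 1 => exists t u, [/\ at_pos w x t, at_pos w y u & cong Gamma t u]
      | 2 => exists t u, [/\ at_pos w x t, at_pos w y u & forall n,
               reaches_size Gamma n u -> reaches_size Gamma n.+1 t]
      | _ => forall (c : symbol S) (hc : arity c = 0),
               unbounded Gamma (const_term hc)
      end
  end.

Lemma meaning_Terms k x y : k <= max_terms ->
  meaning (Terms k) x y = terms_between w k x y.
Proof. by move=> kN; rewrite /= inordK. Qed.

Lemma meaning_Start x y : meaning Start x y =
  exists2 G, {subset G <= Gamma} & drop x w = eqs_word G.
Proof. by rewrite /= inordK. Qed.

Lemma meaning_Eq x y : meaning Eq x y =
  exists t u, [/\ at_pos w x t, at_pos w y u & cong Gamma t u].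
Proof. by rewrite /= inordK. Qed.

Lemma meaning_Reach x y : meaning Reach x y =
  exists t u, [/\ at_pos w x t, at_pos w y u & forall n,
    reaches_size Gamma n u -> reaches_size Gamma n.+1 t].
Proof. by rewrite /= inordK. Qed.

Lemma meaning_Goal x y : meaning Goal x y =
  forall (c : symbol S) (hc : arity c = 0), unbounded Gamma (const_term hc).
Proof. by rewrite /= inordK. Qed.

Lemma terms_between_cons k x y z :
  terms_between w 1 x y -> terms_between w k y z -> terms_between w k.+1 x z.
Proof.
move=> /at_pos_terms[t _ Ex] [us [<- zw Ey]]; exists (t :: us); split=> //.
by rewrite Ex Ey catA.
Qed.

Lemma start_equation x t s G : drop x w = eqs_word G ->
  drop x w = term_word t ++ s ->
  exists q G', G = (t, q) :: G' /\ s = term_word q ++ eqs_word G'.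
Proof.
move=> -> ; case: G => [|[p q] G']; first by rewrite term_wordE.
rewrite /eqs_word /= -catA => /esym/term_word_inj[-> ->].
by exists q, G'.
Qed.

Lemma sound_start x y : terms_between w 2 x y -> meaning Start x x ->
  meaning Start y y.
Proof.
rewrite !meaning_Start => -[[|p [|q [|r us]]] [//= _ yw Ey]] [G sG EG].
rewrite /words /= cats0 -catA in Ey.
have [q' [G' [EG' Es]]] := start_equation EG Ey.
have [_ Ey'] := term_word_inj Es.
by exists G' => // e eG'; apply: sG; rewrite EG' inE eG' orbT.
Qed.

Lemma sound_ax x y : terms_between w 1 x y -> meaning Start x x ->
  meaning Eq x y.
Proof.
rewrite meaning_Start meaning_Eq => /at_pos_terms[p xp Ex] [G sG EG].
have [q [G' [EG' Es]]] := start_equation EG Ex.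
exists p, q; split=> //; first by exists (eqs_word G').
by apply/cong_ax/sG; rewrite EG' mem_head.
Qed.

Lemma sound_cong (f : symbol S) x y x' y' (cx cy : nat -> nat) :
  letter w x = Some f -> letter w y = Some f ->
  terms_between w 1 x x' -> terms_between w 1 y y' ->
  (forall i : 'I_(arity f), [/\ terms_between w i x.+1 (cx i),
     terms_between w i y.+1 (cy i) & meaning Eq (cx i) (cy i)]) ->
  meaning Eq x y.
Proof.
move=> xf yf /at_pos_terms[t xt _] /at_pos_terms[u yu _] args.
rewrite meaning_Eq; exists t, u; split=> //.
have tf := at_pos_root_eq xt xf; have uf := at_pos_root_eq yu yf.
apply: cong_children => [|i]; first by rewrite tf.
rewrite tf => ilt; have [xi yi] := args (Ordinal ilt).
rewrite meaning_Eq => -[t' [u' [xt' yu' tu']]].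
have -> : nth t (children t) i = t'.
  by apply: at_pos_inj xt'; apply: at_pos_child xi; rewrite ?tf.
have -> : nth u (children u) i = u'; last by [].
by apply: at_pos_inj yu'; apply: at_pos_child yi; rewrite ?uf.
Qed.

Lemma sound_reach (f : symbol S) (i : 'I_(arity f)) x y z :
  meaning Eq x y -> letter w y = Some f -> terms_between w i y.+1 z ->
  meaning Reach x z.
Proof.
rewrite meaning_Eq meaning_Reach => -[t [u [xt yu tu]]] yf iz.
have uf := at_pos_root_eq yu yf.
have ilt : i < arity (root u) by rewrite uf.
exists t, (nth u (children u) i); split=> //; first exact: at_pos_child iz.
move=> n Hn; apply: reaches_size_cong tu _; apply: reaches_size_child Hn.
by rewrite mem_nth // size_children.
Qed.

Lemma sound_reach_trans x y z :
  meaning Reach x y -> meaning Reach y z -> meaning Reach x z.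
Proof.
rewrite !meaning_Reach => -[t [u [xt yu tu]]] [u' [v [yu' zv uv]]].
have E := at_pos_inj yu yu'; subst u'.
exists t, v; split=> // n /uv /tu; apply: reaches_size_leq; exact: leqnSn.
Qed.

(** The loop at [y] raises the reachable size by one each time, so the term there is unbounded, and
    the constant inherits this. *)
Lemma sound_goal (c : symbol S) (hc : arity c = 0) x y :
  letter w x = Some c -> meaning Reach x y -> meaning Reach y y ->
  unbounded Gamma (const_term hc).
Proof.
rewrite !meaning_Reach => xc [t [u [xt yu tu]]] [u' [v [yu' yv uv]]].
have E := at_pos_inj yu yu'; subst u'.
have E := at_pos_inj yu yv; subst v.
have uu n : reaches_size Gamma n u.
  elim: n => [|n /uv //]; exists u => //; exact: cong_refl.
have -> : const_term hc = t.
  have tc := at_pos_root_eq xt xc; case: (t) tc => f ts /= Ef.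
  by subst f; rewrite App_const.
move=> n; apply: reaches_size_leq (tu n (uu n)); exact: leqnSn.
Qed.

Lemma program_sound : Forall (closed_rule w meaning) program.
Proof.
rewrite /program !Forall_cat !Forall_enum_map Forall_enum_flatten.
split; last split; last split; last split.
- split; last split; last split; last split; last split; last split;
    last split; last split=> //.
  + move=> x xw _; rewrite meaning_Terms //; exists [::]; split=> //; exact: xw.
  + move=> x xw [x0 _]; have {}x0 : x 0 = 0 := x0.
    by rewrite meaning_Start; exists Gamma; rewrite // x0 drop0.
  + move=> x xw [st [+ _]]; rewrite /atom_holds meaning_Terms // add0n.
    by move/sound_start; apply.
  + move=> x xw [st [+ _]]; rewrite /atom_holds meaning_Terms // add0n.
    by move/sound_ax; apply.
  + move=> x xw [+ _]; rewrite /atom_holds !meaning_Eq add0n.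
    move=> [t [u [xt yu tu]]]; exists u, t; split=> //; exact: cong_sym.
  + move=> x xw [+ [+ _]]; rewrite /atom_holds !meaning_Eq !add0n.
    move=> [t [u [xt yu tu]]] [u' [v [yu' zv uv]]].
    have E := at_pos_inj yu yu'; subst u'.
    by exists t, v; split=> //; apply: cong_trans uv.
  + by move=> x xw [xy [yz _]]; apply: sound_reach_trans xy yz.
  + move=> x xw [_ /Forall_enum_flatten args]; rewrite meaning_Goal => c hc.
    have := args c; rewrite hc eqxx => -[xc [xy [yy _]]].
    exact: sound_goal xc xy yy.
- move=> f x xw [xf [+ _]]; rewrite /atom_holds !meaning_Terms //; last first.
    exact/ltnW/arity_lt.
  rewrite add1n => -[us [Eus yw Ey]].
  have [t tf tus] := term_of_children Eus.
  exists [:: t]; split=> //; have [_ ->] := letter_drop xf.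
  by rewrite /words /= cats0 term_wordE tf tus Ey.
- move=> f x xw [xf [yf [+ [+ /Forall_enum_flatten args]]]].
  rewrite /atom_holds !meaning_Terms // !add0n => xx' yy'.
  apply: (sound_cong (cx := fun i => x i.*2.+4) (cy := fun i => x i.*2.+1.+4)
    xf yf xx' yy') => i.
  have iN : i <= max_terms by rewrite ltnW // (ltn_trans _ (arity_lt f)).
  have [xi [yi [E _]]] := args i; split=> //.
    by move: xi; rewrite /atom_holds meaning_Terms // add1n.
  by move: yi; rewrite /atom_holds meaning_Terms // add1n.
- move=> k x xw [+ [+ _]]; have kN := ltn_ord k.
  rewrite /atom_holds (@meaning_Terms 1) // (@meaning_Terms k) ?(ltnW kN) //.
  rewrite (@meaning_Terms k.+1) //; exact: terms_between_cons.
- move=> f; apply/Forall_enum_map => i x xw [xy [yf [+ _]]].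
  rewrite /atom_holds meaning_Terms; last first.
    by rewrite ltnW // (ltn_trans _ (arity_lt f)).
  exact: sound_reach xy yf.
Qed.

(** ** Completeness *)

Section Model.
Variable R : tag -> nat -> nat -> Prop.
Hypothesis closed_R : Forall (closed_rule w R) program.

Let nat_fun (s : seq nat) : nat -> nat := nth 0 s.

Lemma nat_fun_leq s : all (fun x => x <= size w) s ->
  forall v, nat_fun s v <= size w.
Proof.
move=> sn v; have [vs|sv] := ltnP v (size s); first exact: (all_nthP 0 sn).
by rewrite /nat_fun nth_default.
Qed.

Lemma closed_parts :
  [/\ Forall (closed_rule w R) (take 8 program),
      forall f, closed_rule w R (app_rule f),
      forall f, closed_rule w R (cong_rule f),
      forall k, closed_rule w R (cons_rule k) &
      forall f (i : 'I_(arity f)), closed_rule w R (reach_rule i)].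
Proof.
move: closed_R; rewrite /program take_size_cat // !Forall_cat !Forall_enum_map.
rewrite Forall_enum_flatten => -[? [? [? [? H]]]]; split=> // f i.
by have := H f; rewrite Forall_enum_map; apply.
Qed.

Lemma R_nil x : x <= size w -> R (Terms 0) x x.
Proof.
have [[H _] _ _ _ _] := closed_parts => xw.
by apply: (H (nat_fun [:: x])) => //; apply: nat_fun_leq; rewrite /= xw.
Qed.

Lemma R_start0 : R Start 0 0.
Proof.
have [[_ [H _]] _ _ _ _] := closed_parts.
by apply: (H (nat_fun [:: 0])) => //; apply: nat_fun_leq.
Qed.

Lemma R_start x y : x <= size w -> y <= size w ->
  R Start x x -> R (Terms 2) x y -> R Start y y.
Proof.
have [[_ [_ [H _]]] _ _ _ _] := closed_parts => xw yw xx xy.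
by apply: (H (nat_fun [:: x; y])) => //; apply: nat_fun_leq; rewrite /= xw yw.
Qed.

Lemma R_ax x y : x <= size w -> y <= size w ->
  R Start x x -> R (Terms 1) x y -> R Eq x y.
Proof.
have [[_ [_ [_ [H _]]]] _ _ _ _] := closed_parts => xw yw xx xy.
by apply: (H (nat_fun [:: x; y])) => //; apply: nat_fun_leq; rewrite /= xw yw.
Qed.

Lemma R_sym x y : x <= size w -> y <= size w -> R Eq x y -> R Eq y x.
Proof.
have [[_ [_ [_ [_ [H _]]]]] _ _ _ _] := closed_parts => xw yw xy.
by apply: (H (nat_fun [:: y; x])) => //; apply: nat_fun_leq; rewrite /= xw yw.
Qed.

Lemma R_trans x y z : x <= size w -> y <= size w -> z <= size w ->
  R Eq x y -> R Eq y z -> R Eq x z.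
Proof.
have [[_ [_ [_ [_ [_ [H _]]]]]] _ _ _ _] := closed_parts => xw yw zw xy yz.
apply: (H (nat_fun [:: x; y; z])) => //; apply: nat_fun_leq.
by rewrite /= xw yw zw.
Qed.

Lemma R_reach_trans x y z : x <= size w -> y <= size w -> z <= size w ->
  R Reach x y -> R Reach y z -> R Reach x z.
Proof.
have [[_ [_ [_ [_ [_ [_ [H _]]]]]]] _ _ _ _] := closed_parts => xw yw zw xy yz.
apply: (H (nat_fun [:: x; y; z])) => //; apply: nat_fun_leq.
by rewrite /= xw yw zw.
Qed.

Lemma R_goal (f : symbol S -> nat * nat) :
  (forall c, (f c).1 <= size w /\ (f c).2 <= size w) ->
  (forall c, arity c = 0 ->
     [/\ letter w (f c).1 = Some c, R Reach (f c).1 (f c).2 &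
         R Reach (f c).2 (f c).2]) ->
  R Goal 0 0.
Proof.
have [[_ [_ [_ [_ [_ [_ [_ [H _]]]]]]]] _ _ _ _] := closed_parts => fw fR.
(* Inverts the numbering of variables in [goal_rule]: the parity of [v'] selects a component of the
   pair and its half the symbol, with 0 as default. *)
pose alpha v := if v is v'.+1 then
  (if odd v' then snd else fst) (nth (0, 0) (map f (enum (symbol S))) v'./2)
  else 0.
apply: (H alpha) => [[|v]|] //=.
  have [vs|sv] := ltnP v./2 (size (enum (symbol S))).
    have [c _] : exists c : symbol S, true.
      by case: (enum (symbol S)) vs => // c; exists c.
    rewrite (nth_map c) //.
    by have [] := fw (nth c (enum (symbol S)) v./2); case: odd.
  rewrite -(size_map f) in sv.
  by rewrite (nth_default _ sv); case: odd.
split=> //; apply/Forall_enum_flatten => c; case: eqP => // c0.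
have cE :
    nth (0, 0) (map f (enum (symbol S))) (index c (enum (symbol S))) = f c.
  by rewrite (nth_map c) ?nth_index ?index_mem ?mem_enum.
have [lc xy yy] := fR c c0.
by rewrite /= !odd_double /= uphalf_double doubleK cE.
Qed.

Lemma R_app f x y : y <= size w -> letter w x = Some f ->
  R (Terms (arity f)) x.+1 y -> R (Terms 1) x y.
Proof.
have [_ H _ _ _] := closed_parts => yw xf xy.
have [/ltnW xw _] := letter_drop xf.
by apply: (H f (nat_fun [:: x; y])) => //; apply: nat_fun_leq; rewrite /= xw yw.
Qed.

Lemma R_cons k x y z : k < max_terms ->
  x <= size w -> y <= size w -> z <= size w ->
  R (Terms 1) x y -> R (Terms k) y z -> R (Terms k.+1) x z.
Proof.
have [_ _ _ H _] := closed_parts => kN xw yw zw xy yz.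
apply: (H (Ordinal kN) (nat_fun [:: x; y; z])) => //; apply: nat_fun_leq.
by rewrite /= xw yw zw.
Qed.

Lemma R_reach f (i : 'I_(arity f)) x y z :
  x <= size w -> z <= size w -> R Eq x y -> letter w y = Some f ->
  R (Terms i) y.+1 z -> R Reach x z.
Proof.
have [_ _ _ _ H] := closed_parts => xw zw xy yf yz.
have [/ltnW yw _] := letter_drop yf.
apply: (H f i (nat_fun [:: x; y; z])) => //; apply: nat_fun_leq.
by rewrite /= xw yw zw.
Qed.

Lemma R_cong f x y x' y' (cx cy : nat -> nat) :
  x' <= size w -> y' <= size w ->
  (forall i, cx i <= size w) -> (forall i, cy i <= size w) ->
  letter w x = Some f -> letter w y = Some f ->
  R (Terms 1) x x' -> R (Terms 1) y y' ->
  (forall i, i < arity f -> [/\ R (Terms i) x.+1 (cx i),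
     R (Terms i) y.+1 (cy i) & R Eq (cx i) (cy i)]) ->
  R Eq x y.
Proof.
have [_ _ H _ _] := closed_parts => xw' yw' cxw cyw xf yf xx' yy' args.
have [/ltnW xw _] := letter_drop xf; have [/ltnW yw _] := letter_drop yf.
pose alpha v := if v is v'.+4 then (if odd v' then cy else cx) v'./2
  else nat_fun [:: x; y; x'; y'] v.
apply: (H f alpha) => [v|].
  case: v => [|[|[|[|v]]]] //=; by case: odd.
do 4 (split=> //); apply/Forall_enum_flatten => i.
have [xi yi E] := args i (ltn_ord i).
by rewrite /= !odd_double /= uphalf_double doubleK.
Qed.

(** * Parsing and equality of occurrences in a model *)

Lemma drop_words_leq x (v s : seq (symbol S)) : x <= size w ->
  drop x w = v ++ s -> x + size v <= size w /\ drop (x + size v) w = s.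
Proof.
move=> xw Ex; split.
  by have := congr1 size Ex; rewrite size_drop size_cat; lia.
by rewrite addnC -drop_drop Ex drop_size_cat.
Qed.

Lemma R_words_in us :
  {in us, forall t, forall x s, drop x w = term_word t ++ s ->
     R (Terms 1) x (x + size (term_word t))} ->
  forall x s, size us <= max_terms -> x <= size w -> drop x w = words us ++ s ->
  R (Terms (size us)) x (x + size (words us)).
Proof.
elim: us => [|t us IH] Ht x s usN xw Ex; first by rewrite addn0; apply: R_nil.
have Ext : drop x w = term_word t ++ (words us ++ s) by rewrite Ex catA.
have [yw Ey] := drop_words_leq xw Ext.
have [zw _] := drop_words_leq yw Ey.
rewrite /words /= size_cat addnA.
apply: (R_cons (y := x + size (term_word t))) => //.
  by apply: Ht Ext; rewrite mem_head.
apply: IH Ey => // [u us' |]; last exact: ltnW.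
  by apply: Ht; rewrite inE us' orbT.
Qed.

Lemma R_term t x s : drop x w = term_word t ++ s ->
  R (Terms 1) x (x + size (term_word t)).
Proof.
elim/children_induction: t x s => t IH x s.
rewrite term_wordE /= => /drop_letter[xw lx Ex].
have [yw _] := drop_words_leq xw Ex.
rewrite addnS -addSn; apply: R_app lx _ => //.
rewrite -size_children; apply: R_words_in Ex => //.
by rewrite size_children ltnW // arity_lt.
Qed.

Lemma R_words us x s : size us <= max_terms -> x <= size w ->
  drop x w = words us ++ s -> R (Terms (size us)) x (x + size (words us)).
Proof. by apply: R_words_in => t _; apply: R_term. Qed.

Lemma R_child x t i : at_pos w x t -> i < arity (root t) ->
  R (Terms i) x.+1 (child_pos x t i).
Proof.
move=> xt ilt; have [xw _ [s Es]] := at_pos_root xt.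
have iE : size (take i (children t)) = i.
  by rewrite size_takel // size_children ltnW.
rewrite -[X in Terms X]iE.
apply: (R_words (s := words (drop i (children t)) ++ s)).
- by rewrite iE ltnW // (ltn_trans ilt) // arity_lt.
- exact: xw.
- by rewrite catA -words_cat cat_take_drop.
Qed.

Lemma R_congruence x y t u : at_pos w x t -> at_pos w y u -> root t = root u ->
  (forall i, i < arity (root t) -> R Eq (child_pos x t i) (child_pos y u i)) ->
  R Eq x y.
Proof.
move=> xt yu Er args.
have [_ lx _] := at_pos_root xt; have [_ ly _] := at_pos_root yu.
have [s Ex] := xt; have [s' Ey] := yu.
apply: R_cong (at_pos_end xt) (at_pos_end yu) _ _ lx _ (R_term Ex) (R_term Ey)
  _.
- by move=> i; apply: child_pos_leq xt.
- by move=> i; apply: child_pos_leq yu.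
- by rewrite Er.
- move=> i ilt; split; [exact: R_child | | exact: args].
  by apply: R_child => //; rewrite -Er.
Qed.

(** By induction on the term, [cong_rule] links all occurrences of it. The case [x = y] is
    reflexivity, for which there is no rule. *)
Lemma R_same_term t x y : at_pos w x t -> at_pos w y t -> R Eq x y.
Proof.
elim/children_induction: t x y => t IH x y xt yt.
apply: (R_congruence xt yt) => // i ilt.
apply: IH (at_child_pos xt ilt) (at_child_pos yt ilt).
by rewrite mem_nth // size_children.
Qed.

(** The word has no separators, so starts of equations are found from left to right; hence the
    induction at the end of [G1]. *)
Lemma start_at G1 G2 : Gamma = G1 ++ G2 ->
  [/\ size (eqs_word G1) <= size w, drop (size (eqs_word G1)) w = eqs_word G2 &
      R Start (size (eqs_word G1)) (size (eqs_word G1))].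
Proof.
move=> EG; have Ew : w = eqs_word G1 ++ eqs_word G2.
  by rewrite /w EG /eqs_word map_cat flatten_cat.
split; [by rewrite Ew size_cat leq_addr | by rewrite Ew drop_size_cat |].
elim/last_ind: G1 G2 EG Ew => [|G1 [p q] IH] G2.
  by move=> *; apply: R_start0.
rewrite cat_rcons => EG Ew.
have Ew1 : w = eqs_word G1 ++ eqs_word ((p, q) :: G2).
  by rewrite /w EG /eqs_word map_cat flatten_cat.
have E2 : eqs_word (rcons G1 (p, q)) = eqs_word G1 ++ words [:: p; q].
  by rewrite /eqs_word map_rcons flatten_rcons /words /= cats0.
have xw : size (eqs_word G1) <= size w by rewrite Ew1 size_cat leq_addr.
have Ex : drop (size (eqs_word G1)) w = words [:: p; q] ++ eqs_word G2.
  by rewrite Ew1 drop_size_cat // /eqs_word /words /= cats0.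
have [yw _] := drop_words_leq xw Ex.
rewrite E2 size_cat; apply: (R_start xw yw (IH _ EG Ew1)).
exact: (@R_words [:: p; q] _ _ _ xw Ex).
Qed.

(** * Completeness of [Eq] and [Reach] *)

Definition E_term t u : Prop :=
  exists x y, [/\ at_pos w x t, at_pos w y u & R Eq x y].

(** Makes [E_term] independent of the chosen occurrences, which its transitivity requires. *)
Lemma E_term_pos t u x y : at_pos w x t -> at_pos w y u -> E_term t u ->
  R Eq x y.
Proof.
move=> xt yu [x' [y' [xt' yu' xy]]].
have [xw yw] := (at_pos_leq xt, at_pos_leq yu).
have [xw' yw'] := (at_pos_leq xt', at_pos_leq yu').
apply: R_trans (R_same_term xt xt') _ => //.
exact: R_trans xy (R_same_term yu' yu).
Qed.

Lemma equation_at p q : (p, q) \in Gamma ->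
  [/\ exists x, at_pos w x p, exists y, at_pos w y q & E_term p q].
Proof.
move=> pq; have [G1 [G2 EG]] : exists G1 G2, Gamma = G1 ++ (p, q) :: G2.
  by case/splitPr: pq => G1 G2; exists G1, G2.
have [xw Ex Rx] := start_at EG; set x := size (eqs_word G1) in xw Ex Rx.
have {}Ex : drop x w = term_word p ++ (term_word q ++ eqs_word G2).
  by rewrite Ex /eqs_word /= catA.
have [yw Ey] := drop_words_leq xw Ex.
have xp : at_pos w x p by eexists; exact: Ex.
have yq : at_pos w (x + size (term_word p)) q by eexists; exact: Ey.
split; [by exists x | by eexists; exact: yq |].
exists x, (x + size (term_word p)); split=> //.
exact: R_ax (R_term Ex).
Qed.

Lemma R_cong_complete t u x y : at_pos w x t -> at_pos w y u ->
  cong Gamma t u -> R Eq x y.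
Proof.
move=> xt yu tu; apply: (E_term_pos xt yu).
apply: (@cong_complete S Gamma (fun t => exists x, at_pos w x t)) tu;
  [| exact: equation_at | | | | | by exists x | by exists y].
- move=> t' u' [z zt] /(nthP t')[i]; rewrite size_children => ilt <-.
  by exists (child_pos z t' i); apply: at_child_pos.
- by move=> t' [z zt]; exists z, z; split=> //; apply: (R_same_term zt zt).
- move=> t' u' [x' [y' [xt' yu' xy]]]; exists y', x'; split=> //.
  exact: R_sym (at_pos_leq xt') (at_pos_leq yu') xy.
- move=> t' u' v [x' [y' [xt' yu' xy]]] uv; have [y2 [z [yu2 zv _]]] := uv.
  exists x', z; split=> //; have yz := E_term_pos yu' zv uv.
  by apply: R_trans xy yz; apply: at_pos_leq; eassumption.
- move=> t' u' [x' xt'] [y' yu'] Er args; exists x', y'; split=> //.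
  apply: (R_congruence xt' yu' Er) => i ilt.
  apply: E_term_pos (args i ilt); apply: at_child_pos => //.
  by rewrite -Er.
Qed.

Lemma side_at q : q \in eqs_sides Gamma -> exists x, at_pos w x q.
Proof.
rewrite mem_undup mem_cat => /orP[] /mapP[[p p'] /equation_at[? ? _] ->] //.
Qed.

Lemma R_reach_child x t y q u :
  at_pos w x t -> at_pos w y q -> cong Gamma t q -> u \in children q ->
  exists z, at_pos w z u /\ R Reach x z.
Proof.
move=> xt yq tq /(nthP q)[i]; rewrite size_children => ilt <-.
exists (child_pos y q i); split; first exact: at_child_pos.
have [_ ly _] := at_pos_root yq.
apply: (R_reach (i := Ordinal ilt)) (R_cong_complete xt yq tq) ly _.
- exact: at_pos_leq xt.
- exact: child_pos_leq yq.
- exact: R_child.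
Qed.

Definition reachb (x y : nat) : bool :=
  `[< [/\ x <= size w, y <= size w & R Reach x y] >].

Lemma reachb_path x y p : path reachb x (rcons p y) -> reachb x y.
Proof.
elim: p x => [|z p IH] x /=; first by rewrite andbT.
move=> /andP[/asboolP[xw zw xz]] /IH/asboolP[_ yw zy].
by apply/asboolP; split=> //; apply: R_reach_trans xz zy.
Qed.

(** The walk that proves the cyclic type is repeated on positions of the word; transitivity of
    [Reach] contracts its cycle to a loop at [y]. *)
Lemma R_unbounded x t : at_pos w x t -> unbounded Gamma t ->
  exists y, [/\ y <= size w, R Reach x y & R Reach y y].
Proof.
move=> xt ut.
have [||p [c [path_p /andP[cyc_c _] last_c]]] := @walk_to_cycle _ reachb
    (iota 0 (size w).+1)
    (fun x => exists2 t, at_pos w x t & unbounded Gamma t) x _ _.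
- move=> z [r zr /unbounded_step[q [u [uq uu [Eq|[qs rq]]]]]].
    subst q; have [y [yu zy]] := R_reach_child zr zr (cong_refl _ r) uq.
    have yw := at_pos_leq yu; have zw := at_pos_leq zr.
    by exists y; split; [apply/asboolP | exists u | rewrite mem_iota ltnS].
  have [y' yq] := side_at qs.
  have [y [yu zy]] := R_reach_child zr yq rq uq.
  have yw := at_pos_leq yu; have zw := at_pos_leq zr.
  by exists y; split; [apply/asboolP | exists u | rewrite mem_iota ltnS].
- by exists t.
set y := last x p in last_c.
have /asboolP[yw _ yy] : reachb y y.
  have [i c' Ec] := rot_to last_c; apply: (reachb_path (p := c')).
  by rewrite -(rot_cycle i) Ec in cyc_c.
exists y; split=> //; move: @y last_c yw yy.
(* For an empty path [y] is [x], and the loop at [y] also serves as the connection from [x]. *)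
case/lastP: p path_p => [|p z] path_p y _ yw yy //.
by have /asboolP[] := reachb_path path_p; rewrite /y last_rcons.
Qed.

(** The side [q] has a child and so is not alike to the constant. Hence the derivation rewrites at
    the root, beginning with a side alike to the constant, which is the constant itself. *)
Lemma unbounded_const_at (c : symbol S) (hc : arity c = 0) :
  unbounded Gamma (const_term hc) -> exists x, at_pos w x (const_term hc).
Proof.
move=> uc; have [q [u [uq _ [Eq|[qs cq]]]]] := unbounded_step uc.
  by move: uq; rewrite Eq /= => /mapP[i]; have := ltn_ord i;
    rewrite [X in _ < X]hc.
have [[f [ts [us [Ec Eq _]]]]|[p [_ [ps _ [f [ts [us [Ec Ep _]]]] _ _]]]]
  := cong_cases cq.
  have fc : f = c by have /= := congr1 (@root S) Ec.
  subst f q; move: uq => /= /mapP[i]; have := ltn_ord i.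
  by rewrite [X in _ < X]hc.
have fc : f = c by have /= := congr1 (@root S) Ec.
by subst f; apply: side_at; rewrite -(App_const hc us) -Ep.
Qed.

Lemma program_complete : all_classes_infinite Gamma -> R Goal 0 0.
Proof.
move=> /all_classes_infinite_consts inf.
have /choice[f Hf] : forall c : symbol S, exists xy : nat * nat,
    (xy.1 <= size w /\ xy.2 <= size w) /\ (arity c = 0 ->
    [/\ letter w xy.1 = Some c, R Reach xy.1 xy.2 & R Reach xy.2 xy.2]).
  move=> c; case: (eqVneq (arity c) 0) => [hc|cn]; last first.
    by exists (0, 0); split=> // hc; rewrite hc in cn.
  have [x xc] := unbounded_const_at (inf c hc).
  have [y [yw xy yy]] := R_unbounded xc (inf c hc).
  have [xw lx _] := at_pos_root xc.
  by exists (x, y); split=> //; split=> //; apply: ltnW.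
by apply: (@R_goal f) => c; have [] := Hf c.
Qed.

End Model.
End Word.
End Program.

Theorem corollary3p9 (S : signature) :
  (forall Gamma : seq (equation S),
     all_classes_infinite Gamma <->
     (forall (c : symbol S) (hc : arity c = 0),
        of_cyclic_type Gamma (const_term hc))) /\
  ptime_decidable (@eqs_word S) (@eqs_size S) (@all_classes_infinite S).
Proof.
split=> [Gamma|]; first exact: all_classes_infinite_cyclic.
have [M [p H]] := datalog_ptime (program S) (Goal S).
exists M, p => Gamma; have [b [ans bP]] := H (eqs_word Gamma).
exists b; split; first by rewrite -size_eqs_word.
(* What holds in every model holds in the model [meaning]; conversely, completeness yields the goal
   atom in an arbitrary model. *)
split=> [/bP least|inf]; last by apply/bP => R; move/program_complete; apply.
apply/all_classes_infinite_consts => c hc.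
by have := least _ (program_sound Gamma); rewrite meaning_Goal; apply.
Qed.
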